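(* Let $\Omega$ be a countably infinite set, $S=\mathrm{Sym}(\Omega)$, and let $\mathcal P$ be the set of partitions $A$ of $\Omega$ into finite subsets such that there is no common finite bound on the cardinalities of the members of $A$. Then the subgroups $S_{(A)}$ with $A\in\mathcal P$ are mutually $\approx$-equivalent, and a closed subgroup $G\le S$ is $\approx$-equivalent to these subgroups if and only if there exists a finite subset $\Gamma\subseteq\Omega$ such that all orbits of $G_{(\Gamma)}$ are finite, but there is no finite $\Gamma\subseteq\Omega$ for which the cardinalities of the orbits of $G_{(\Gamma)}$ have a common finite bound. Moreover, for $A\in\mathcal P$ one has $S_{(A)}\prec S$.
   Context: $\mathrm{Sym}(\Omega)$ is the group of all permutations of $\Omega$ (acting on the right). $S$ carries the function topology (pointwise convergence, $\Omega$ discrete); ''closed'' means closed in $S$. For a partition $A$ of $\Omega$, $S_{(A)}=\{f\in S:\Sigma f=\Sigma\text{ for all }\Sigma\in A\}$. For $G\le S$ and $\Gamma\subseteq\Omega$, $G_{(\Gamma)}$ is the pointwise stabilizer of $\Gamma$ in $G$. For subgroups $G_1,G_2\le S$: $G_1\preccurlyeq G_2$ means there is a finite $U\subseteq S$ with $G_1\le\langle G_2\cup U\rangle$; $G_1\approx G_2$ means $G_1\preccurlyeq G_2$ and $G_2\preccurlyeq G_1$; $G_1\prec G_2$ means $G_1\preccurlyeq G_2$ and not $G_2\preccurlyeq G_1$. *)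

(* Defs.v *)
(* Permutation groups on a countably infinite set Omega,
   given as an arbitrary type T in bijection with nat. Permutations are
   bijective functions T -> T (equality = Leibniz equality of functions). *)
From Stdlib Require Import List.
Import ListNotations.

Section Defs.
Variable T : Type.

Definition bij {A B : Type} (f : A -> B) : Prop :=
  exists g : B -> A, (forall x, g (f x) = x) /\ (forall y, f (g y) = y).

Definition countably_infinite : Prop := exists e : nat -> T, bij e.

Definition Sym (f : T -> T) : Prop := bij f.

Definition is_subgroup (G : (T -> T) -> Prop) : Prop :=
  (forall f, G f -> Sym f) /\
  G (fun x => x) /\
  (forall f g, G f -> G g -> G (fun x => g (f x))) /\
  (forall f, G f -> exists g, G g /\ (forall x, g (f x) = x) /\ (forall y, f (g y) = y)).

Definition subset (G H : (T -> T) -> Prop) : Prop := forall f, G f -> H f.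

(* closed in S for the topology of pointwise convergence (Omega discrete) *)
Definition closed_in_S (G : (T -> T) -> Prop) : Prop :=
  forall f, Sym f ->
    (forall Gamma : list T, exists g, G g /\ forall x, In x Gamma -> g x = f x) ->
    G f.

Definition generated (G : (T -> T) -> Prop) (U : list (T -> T)) (f : T -> T) : Prop :=
  forall H, is_subgroup H -> subset G H -> (forall u, In u U -> H u) -> H f.

Definition preceq (G1 G2 : (T -> T) -> Prop) : Prop :=
  exists U : list (T -> T), (forall u, In u U -> Sym u) /\ subset G1 (generated G2 U).

Definition approx (G1 G2 : (T -> T) -> Prop) : Prop := preceq G1 G2 /\ preceq G2 G1.

Definition prec (G1 G2 : (T -> T) -> Prop) : Prop := preceq G1 G2 /\ ~ preceq G2 G1.

Definition finite_set (X : T -> Prop) : Prop :=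
  exists l : list T, forall x, X x -> In x l.

Definition card_le (X : T -> Prop) (n : nat) : Prop :=
  exists l : list T, length l <= n /\ forall x, X x -> In x l.

Definition is_partition (A : (T -> Prop) -> Prop) : Prop :=
  (forall Sigma, A Sigma -> exists x, Sigma x) /\
  (forall x, exists Sigma, A Sigma /\ Sigma x) /\
  (forall Sigma1 Sigma2 x, A Sigma1 -> A Sigma2 -> Sigma1 x -> Sigma2 x ->
     forall y, Sigma1 y <-> Sigma2 y).

Definition in_P (A : (T -> Prop) -> Prop) : Prop :=
  is_partition A /\
  (forall Sigma, A Sigma -> finite_set Sigma) /\
  ~ (exists n, forall Sigma, A Sigma -> card_le Sigma n).

(* image of a set under f (right action: Sigma f) *)
Definition image (X : T -> Prop) (f : T -> T) (y : T) : Prop := exists x, X x /\ f x = y.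

Definition S_A (A : (T -> Prop) -> Prop) (f : T -> T) : Prop :=
  Sym f /\ forall Sigma, A Sigma -> forall y, image Sigma f y <-> Sigma y.

Definition pstab (G : (T -> T) -> Prop) (Gamma : list T) (g : T -> T) : Prop :=
  G g /\ forall x, In x Gamma -> g x = x.

Definition orbit (H : (T -> T) -> Prop) (x : T) (y : T) : Prop := exists h, H h /\ h x = y.

Definition all_orbits_finite (H : (T -> T) -> Prop) : Prop :=
  forall x, finite_set (orbit H x).

Definition orbits_bounded (H : (T -> T) -> Prop) : Prop :=
  exists n, forall x, card_le (orbit H x) n.

End Defs.

(* Main.v *)
Require Import Defs.
From Stdlib Require Import List Arith Lia ZArith Cantor.
From Stdlib Require Import Classical ClassicalEpsilon FunctionalExtensionality.

(** A ladder is a sequence of disjoint finite sets (rungs) of growing size; its rung group consists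
    of the permutations that preserve every rung and fix all other points. Everything is compared
    with rung groups.

    - Given an integer-valued metric with finite balls, cut Omega into finite levels so that a
      permutation of bounded displacement moves, up to a finitary correction, each point by at most
      one level. Such a permutation is an involution exchanging the points that cross between
      neighbouring levels (equally many in both directions), followed by a permutation preserving
      the levels. Splitting modulo 4 puts each factor into one of four conjugates of the rung group
      of any ladder. Hence bounded displacement groups are below every rung group.
    - S_(A) has bounded displacement in a metric with finite balls, even after adjoining finitely
      many permutations, and contains a rung group. Such a metric exists for G as soon as some
      G_(Gamma) has finite orbits, since G_(Gamma) has countable index, and if the orbits are
      uniformly bounded then so are the balls; a diagonal element of a rung group then shows that
      S_(A) is not below G.
    - If G is closed and every G_(Gamma) has an infinite orbit, a limit of elements of G has
      unbounded displacement.
    - If G is closed and the orbits of every G_(Gamma) are unbounded, limits along a finitely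
      branching tree give elements g_f of G, one for each permutation f of the index set preserving
      certain finite blocks, such that the points g_f(x_t) are pairwise distinct except when forced
      to coincide. One fixed permutation s matches g_f(x_t) with g_(f^-1)(x_(f t)), so that
      g_(f^-1)^-1 s g_f induces f on the x_t; a shift then removes the action off these points. *)

(** * Choice principles, counting, and ranks in infinite sets of naturals *)

Lemma choice_fun (A B : Type) (R : A -> B -> Prop) :
  (forall x, exists y, R x y) -> exists f, forall x, R x (f x).
Proof.
  intros H.
  exists (fun x => proj1_sig (constructive_indefinite_description _ (H x))).
  intros x. apply proj2_sig.
Qed.

Lemma dependent_choice (A : Type) (Inv : nat -> A -> Prop) (Step : nat -> A -> A -> Prop) (a0 : A) :
  Inv 0 a0 ->
  (forall k a, Inv k a -> exists b, Inv (S k) b /\ Step k a b) ->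
  exists s : nat -> A, forall k, Inv k (s k) /\ Step k (s k) (s (S k)).
Proof.
  intros H0 HS.
  destruct (choice_fun (nat * A) A (fun p b => Inv (fst p) (snd p) ->
    Inv (S (fst p)) b /\ Step (fst p) (snd p) b)) as [nx Hnx].
  { intros [k a]. simpl. destruct (classic (Inv k a)) as [Hi|Hi].
    - destruct (HS k a Hi) as [b Hb]. exists b. auto.
    - exists a. tauto. }
  set (s := fix s k := match k with 0 => a0 | S k => nx (k, s k) end).
  assert (HI : forall k, Inv k (s k)).
  { induction k as [|k IH]; [exact H0|]. exact (proj1 (Hnx (k, s k) IH)). }
  exists s. intros k. split; [apply HI|]. exact (proj2 (Hnx (k, s k) (HI k))).
Qed.

Lemma bij_of_relation (A B : Type) (R : A -> B -> Prop) :
  (forall x, exists y, R x y) -> (forall y, exists x, R x y) ->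
  (forall x y y', R x y -> R x y' -> y = y') ->
  (forall x x' y, R x y -> R x' y -> x = x') ->
  exists f, bij f /\ forall x, R x (f x).
Proof.
  intros Ht Hs Hf Hi.
  destruct (choice_fun _ _ R Ht) as [f Rf].
  destruct (choice_fun _ _ (fun y x => R x y) Hs) as [g Rg].
  exists f. split; [|exact Rf].
  exists g. split; intros z; eauto.
Qed.

Lemma list_max_bound (A : Type) (h : A -> nat) (l : list A) :
  exists N, forall x, In x l -> h x <= N.
Proof.
  induction l as [|a l [N IH]].
  - exists 0. simpl. tauto.
  - exists (h a + N). intros x [<-|Hx]; [lia|]. specialize (IH x Hx). lia.
Qed.

Lemma injective_escapes_list (A : Type) (s : nat -> A) (l : list A) :
  (forall n m, s n = s m -> n = m) -> exists n, ~ In (s n) l.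
Proof.
  intros Hi. apply NNPP. intros Hn.
  assert (Hd : NoDup (map s (seq 0 (S (length l))))).
  { apply NoDup_map_NoDup_ForallPairs; [|apply seq_NoDup]. intros a b _ _. apply Hi. }
  assert (Hl : incl (map s (seq 0 (S (length l)))) l).
  { intros z Hz. apply in_map_iff in Hz. destruct Hz as [n [<- _]].
    apply NNPP. intros Hz. apply Hn. exists n. exact Hz. }
  pose proof (NoDup_incl_length Hd Hl) as H. rewrite length_map, length_seq in H. lia.
Qed.

Section Rank.
Variable P : nat -> Prop.

(** Counts the elements of [P] below [n]; on an infinite [P] it is the order isomorphism onto the
    naturals. *)
Fixpoint rank (n : nat) : nat :=
  match n with
  | 0 => 0
  | S m => rank m + (if excluded_middle_informative (P m) then 1 else 0)
  end.

Lemma rank_mono n m : n <= m -> rank n <= rank m.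
Proof. induction 1; simpl; lia. Qed.

Lemma rank_S n : P n -> rank (S n) = S (rank n).
Proof. intros H. simpl. destruct (excluded_middle_informative (P n)); [lia|tauto]. Qed.

Lemma rank_inj n m : P n -> P m -> rank n = rank m -> n = m.
Proof.
  intros Hn Hm E.
  destruct (lt_eq_lt_dec n m) as [[H|H]|H]; [|exact H|]; apply rank_mono in H;
    rewrite rank_S in H; auto; lia.
Qed.

Lemma rank_attained n m : n < rank m -> exists k, P k /\ rank k = n.
Proof.
  induction m as [|m IH]; simpl; intros H; [lia|].
  destruct (excluded_middle_informative (P m)) as [Hp|Hp].
  - destruct (Nat.eq_dec (rank m) n) as [E|E]; [eauto|]. apply IH. lia.
  - apply IH. lia.
Qed.

Lemma rank_surj : (forall N, exists k, N <= k /\ P k) -> forall n, exists k, P k /\ rank k = n.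
Proof.
  intros Hinf n. cut (exists m, n < rank m).
  { intros [m Hm]. exact (rank_attained n m Hm). }
  induction n as [|n [m Hm]].
  - destruct (Hinf 0) as [k [_ Hk]]. exists (S k). rewrite rank_S; auto; lia.
  - destruct (Hinf m) as [k [Hmk Hk]]. exists (S k). rewrite rank_S; auto.
    pose proof (rank_mono m k Hmk). lia.
Qed.
End Rank.

(** * Permutations, generated subgroups and finite combinatorics *)

Section Permutations.
Variable T : Type.
Implicit Types (f g h : T -> T) (x y z : T) (l : list T).

Definition inverse f g : Prop := (forall x, g (f x) = x) /\ (forall y, f (g y) = y).

Lemma inverse_sym f g : inverse f g -> inverse g f.
Proof. intros [H1 H2]. split; auto. Qed.

Lemma inverse_Sym f g : inverse f g -> Sym T f.
Proof. intros H. exists g. exact H. Qed.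

Lemma Sym_inj f x y : Sym T f -> f x = f y -> x = y.
Proof. intros [g [H _]] E. rewrite <- (H x), <- (H y), E. reflexivity. Qed.

Lemma Sym_comp f g : Sym T f -> Sym T g -> Sym T (fun x => g (f x)).
Proof.
  intros [f' [Hf1 Hf2]] [g' [Hg1 Hg2]]. exists (fun x => f' (g' x)).
  split; intros z; congruence.
Qed.

Lemma Sym_subgroup : is_subgroup T (Sym T).
Proof.
  split; [auto|]. split.
  { exists (fun x => x). auto. }
  split; [exact Sym_comp|].
  intros f [g Hg]. exists g. split; [|exact Hg].
  exact (inverse_Sym _ _ (inverse_sym _ _ Hg)).
Qed.

Lemma subgroup_comp G f g : is_subgroup T G -> G f -> G g -> G (fun x => g (f x)).
Proof. intros [_ [_ [H _]]]. apply H. Qed.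

Lemma subgroup_inverse G f g : is_subgroup T G -> G f -> inverse f g -> G g.
Proof.
  intros [_ [_ [_ H]]] Hf [H1 H2]. destruct (H f Hf) as [g' [Hg' [E1 E2]]].
  replace g with g'; [exact Hg'|]. apply functional_extensionality. intros x.
  rewrite <- (H2 x) at 1. apply E1.
Qed.

Lemma generated_subgroup G U :
  (forall f, G f -> Sym T f) -> (forall u, In u U -> Sym T u) ->
  is_subgroup T (generated T G U).
Proof.
  intros HG HU.
  assert (HS : forall f, generated T G U f -> Sym T f).
  { intros f Hf. apply (Hf _ Sym_subgroup HG HU). }
  split; [exact HS|]. split.
  { intros H HH _ _. apply HH. }
  split.
  { intros f g Hf Hg H HH HGH HUH. apply subgroup_comp; [exact HH|apply Hf|apply Hg]; auto. }
  intros f Hf. destruct (HS f Hf) as [g Hg]. exists g. split; [|exact Hg].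
  intros H HH HGH HUH. apply (subgroup_inverse H f g HH); [apply Hf; auto|exact Hg].
Qed.

Lemma generated_base G U f : G f -> generated T G U f.
Proof. intros Hf H _ HG _. apply HG, Hf. Qed.

Lemma generated_trans (X Y G : (T -> T) -> Prop) U V :
  subset T X (generated T Y U) -> subset T Y (generated T G V) ->
  subset T X (generated T G (U ++ V)).
Proof.
  intros HX HY f Hf H HH HG HUV. apply (HX f Hf H HH).
  - intros g Hg. apply (HY g Hg H HH HG). intros u Hu. apply HUV, in_or_app. auto.
  - intros u Hu. apply HUV, in_or_app. auto.
Qed.

Lemma preceq_trans X Y G : preceq T X Y -> preceq T Y G -> preceq T X G.
Proof.
  intros [U [HU HX]] [V [HV HY]]. exists (U ++ V). split.
  - intros u Hu. apply in_app_or in Hu. destruct Hu; auto.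
  - exact (generated_trans _ _ _ _ _ HX HY).
Qed.

Lemma subset_preceq X Y : subset T X Y -> preceq T X Y.
Proof.
  intros H. exists nil. split; [simpl; tauto|]. intros f Hf. apply generated_base; auto.
Qed.

Lemma involution_of_matching (M : T -> T -> Prop) :
  (forall x y, M x y -> M y x) -> (forall x y y', M x y -> M x y' -> y = y') ->
  exists t, inverse t t /\ (forall x y, M x y -> t x = y) /\
    (forall x, (forall y, ~ M x y) -> t x = x).
Proof.
  intros Hs Hf.
  destruct (choice_fun _ _ (fun x y => M x y \/ ((forall y, ~ M x y) /\ y = x))) as [t Ht].
  { intros x. destruct (classic (exists y, M x y)) as [[y Hy]|H]; [eauto|].
    exists x. right. split; [|reflexivity]. intros y Hy. apply H. eauto. }
  assert (HM : forall x y, M x y -> t x = y).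
  { intros x y Hxy. destruct (Ht x) as [H|[H _]]; [eauto|]. destruct (H y Hxy). }
  assert (HN : forall x, (forall y, ~ M x y) -> t x = x).
  { intros x Hx. destruct (Ht x) as [H|[_ H]]; [destruct (Hx _ H)|exact H]. }
  assert (Htt : forall x, t (t x) = x).
  { intros x. destruct (Ht x) as [H|[H E]]; [auto|]. rewrite E. exact E. }
  exists t. split; [split; exact Htt|]. auto.
Qed.

Definition swap x y z : T :=
  if excluded_middle_informative (z = x) then y
  else if excluded_middle_informative (z = y) then x else z.

Ltac swap_cases :=
  unfold swap; repeat (destruct (excluded_middle_informative _); subst); try congruence.

Lemma swap_l x y : swap x y x = y.
Proof. swap_cases. Qed.

Lemma swap_r x y : swap x y y = x.
Proof. swap_cases. Qed.

Lemma swap_other x y z : z <> x -> z <> y -> swap x y z = z.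
Proof. swap_cases. Qed.

Lemma swap_inverse x y : inverse (swap x y) (swap x y).
Proof. split; intros z; swap_cases. Qed.

Lemma swap_comm x y : swap x y = swap y x.
Proof. apply functional_extensionality. intros z. swap_cases. Qed.

Lemma swap_conj x y z w : z <> x -> z <> y -> x <> y ->
  swap z y (swap x z (swap z y w)) = swap x y w.
Proof. intros. swap_cases. Qed.

(** Induction: the transposition of the two heads commutes with the involution obtained from the
    tails, which fixes both heads. *)
Lemma exchange_lists la lb : NoDup la -> NoDup lb -> length la = length lb ->
  (forall x, In x la -> ~ In x lb) ->
  exists p, inverse p p /\ (forall x, In x la -> In (p x) lb) /\
    (forall x, In x lb -> In (p x) la) /\ (forall x, ~ In x la -> ~ In x lb -> p x = x).
Proof.
  revert lb. induction la as [|a la IH]; intros [|b lb] Ha Hb Hl Hd; try discriminate Hl.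
  { exists (fun x => x). split; [split; auto|]. simpl. tauto. }
  inversion Ha as [|? ? Ha1 Ha2]; inversion Hb as [|? ? Hb1 Hb2]; subst.
  destruct (IH lb) as [p [[Hp _] [H1 [H2 H3]]]]; auto.
  { intros x Hx Hx'. apply (Hd x); simpl; auto. }
  assert (Hab : a <> b). { intros ->. apply (Hd b); simpl; auto. }
  assert (Halb : ~ In a lb). { intros H. apply (Hd a); simpl; auto. }
  assert (Hbla : ~ In b la). { intros H. apply (Hd b); simpl; auto. }
  assert (Hpa : p a = a) by auto. assert (Hpb : p b = b) by auto.
  assert (Hpab : forall z, z <> a -> z <> b -> p z <> a /\ p z <> b).
  { intros z Hz1 Hz2. split; intros E; apply (f_equal p) in E; rewrite Hp in E; congruence. }
  exists (fun z => swap a b (p z)).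
  assert (Hcase : forall z, (z = a /\ swap a b (p z) = b) \/ (z = b /\ swap a b (p z) = a) \/
     (z <> a /\ z <> b /\ swap a b (p z) = p z)).
  { intros z. destruct (classic (z = a)) as [->|Ez]; [rewrite Hpa, swap_l; auto|].
    destruct (classic (z = b)) as [->|Ez']; [rewrite Hpb, swap_r; auto|].
    destruct (Hpab z Ez Ez'). right. right. repeat split; auto. apply swap_other; auto. }
  assert (Hinv : forall z, swap a b (p (swap a b (p z))) = z).
  { intros z. destruct (Hcase z) as [[-> ->]|[[-> ->]|[E1 [E2 ->]]]].
    - rewrite Hpb. apply swap_r.
    - rewrite Hpa. apply swap_l.
    - rewrite Hp. apply swap_other; auto. }
  split; [split; exact Hinv|].
  split; [|split].
  - intros z Hz. destruct (Hcase z) as [[-> ->]|[[-> ->]|[E1 [E2 ->]]]]; simpl; auto.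
    + exfalso. simpl in Hz. destruct Hz; auto.
    + simpl in Hz. destruct Hz; [congruence|auto].
  - intros z Hz. destruct (Hcase z) as [[-> ->]|[[-> ->]|[E1 [E2 ->]]]]; simpl; auto.
    + exfalso. simpl in Hz. destruct Hz; auto.
    + simpl in Hz. destruct Hz; [congruence|auto].
  - simpl. intros z Hz1 Hz2. destruct (Hcase z) as [[E _]|[[E _]|[E1 [E2 ->]]]].
    + destruct Hz1. auto.
    + destruct Hz2. auto.
    + apply H3; tauto.
Qed.

Lemma finite_set_NoDup (X : T -> Prop) : finite_set T X ->
  exists l, NoDup l /\ forall x, In x l <-> X x.
Proof.
  intros [l Hl].
  pose (dec := fun x y : T => excluded_middle_informative (x = y)).
  pose (p := fun x => if excluded_middle_informative (X x) then true else false).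
  exists (filter p (nodup dec l)). split.
  { apply NoDup_filter, NoDup_nodup. }
  intros x. rewrite filter_In, nodup_In. unfold p.
  destruct (excluded_middle_informative (X x)) as [H|H].
  - split; auto.
  - split; [intros [_ E]; discriminate E|tauto].
Qed.

Lemma finite_union (I : Type) (X : I -> T -> Prop) (r : list I) :
  (forall i, In i r -> finite_set T (X i)) ->
  finite_set T (fun x => exists i, In i r /\ X i x).
Proof.
  induction r as [|i r IH]; intros H.
  - exists nil. intros x [j [[] _]].
  - destruct (IH (fun j Hj => H j (or_intror Hj))) as [l Hl].
    destruct (H i (or_introl eq_refl)) as [l' Hl'].
    exists (l' ++ l). intros x [j [[->|Hj] Hx]]; apply in_or_app; eauto.
Qed.

Lemma not_card_le_escape (X : T -> Prop) n l :
  ~ card_le T X n -> length l <= n -> exists x, X x /\ ~ In x l.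
Proof.
  intros H Hl. apply NNPP. intros Hn. apply H. exists l. split; [exact Hl|].
  intros x Hx. apply NNPP. intros Hx'. apply Hn. eauto.
Qed.

(** Greedy choice: a set with more than [n] points has a free one while at most [n] are taken, which
    the length condition guarantees at every step. *)
Lemma distinct_representatives (t0 : T) (I : Type) (items : list I) (P : I -> T -> Prop) used n :
  (forall i, In i items -> ~ card_le T (P i) n) -> length used + length items <= S n ->
  exists b : I -> T, (forall i, In i items -> P i (b i) /\ ~ In (b i) used) /\
    (forall i j, In i items -> In j items -> b i = b j -> i = j).
Proof.
  revert used. induction items as [|i items IH]; intros used HP Hn.
  { exists (fun _ => t0). simpl. tauto. }
  simpl in Hn.
  destruct (not_card_le_escape (P i) n used) as [y [Hy Hyu]]; [apply HP; simpl; auto|lia|].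
  destruct (IH (y :: used)) as [b [Hb Hbi]].
  { intros j Hj. apply HP. simpl. auto. }
  { simpl. lia. }
  exists (fun j => if excluded_middle_informative (j = i) then y else b j). split.
  - intros j [<-|Hj]; destruct (excluded_middle_informative _) as [E|E]; subst; try tauto.
    destruct (Hb j Hj) as [H1 H2]. simpl in H2. tauto.
  - assert (Hy' : forall j, In j (i :: items) -> j <> i -> b j <> y).
    { intros j [E|Hj] Hji; [congruence|]. destruct (Hb j Hj) as [_ H2]. simpl in H2. auto. }
    intros j k Hj Hk.
    destruct (excluded_middle_informative (j = i)) as [Ej|Ej];
    destruct (excluded_middle_informative (k = i)) as [Ek|Ek]; subst; auto.
    + intros E. destruct (Hy' k Hk Ek). auto.
    + intros E. destruct (Hy' j Hj Ej). auto.
    + destruct Hj as [Hj|Hj]; [congruence|]. destruct Hk as [Hk|Hk]; [congruence|]. auto.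
Qed.

Lemma card_le_mono (X : T -> Prop) n m : n <= m -> card_le T X n -> card_le T X m.
Proof. intros Hnm [l [Hl H]]. exists l. split; [lia|exact H]. Qed.

Lemma not_card_le_inj (t0 : T) (X : T -> Prop) n : ~ card_le T X n ->
  exists d : nat -> T, (forall a, a <= n -> X (d a)) /\
    (forall a b, a <= n -> b <= n -> d a = d b -> a = b).
Proof.
  intros H.
  destruct (distinct_representatives t0 nat (seq 0 (S n)) (fun _ => X) nil n) as [d [H1 H2]].
  - auto.
  - rewrite length_seq. simpl. lia.
  - exists d. split.
    + intros a Ha. apply H1, in_seq. lia.
    + intros a b Ha Hb. apply H2; apply in_seq; lia.
Qed.

End Permutations.

(** * Word metrics and bounded displacement *)

Section Gauges.
Variable T : Type.
Implicit Types (f g h : T -> T) (x y z : T) (l : list T).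

(* [R k x y] reads "x and y are at distance at most k" for a generalized integer-valued metric. *)
Record gauge (R : nat -> T -> T -> Prop) : Prop := {
  gauge_refl : forall k x, R k x x;
  gauge_sym : forall k x y, R k x y -> R k y x;
  gauge_mono : forall k m x y, k <= m -> R k x y -> R m x y;
  gauge_comp : forall k m x y z, R k x y -> R m y z -> R (k + m) x z }.

Definition bounded_displacement (R : nat -> T -> T -> Prop) f : Prop :=
  Sym T f /\ exists k, forall x, R k x (f x).

Lemma bounded_displacement_subgroup R : gauge R -> is_subgroup T (bounded_displacement R).
Proof.
  intros HR. split; [intros f [H _]; exact H|]. split.
  { split; [exact (proj1 (proj2 (Sym_subgroup T)))|]. exists 0. apply (gauge_refl _ HR). }
  split.
  { intros f g [Sf [k Hk]] [Sg [m Hm]]. split; [apply Sym_comp; auto|].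
    exists (k + m). intros x. apply (gauge_comp _ HR _ _ _ (f x)); auto. }
  intros f [[g Hg] [k Hk]]. exists g. split; [|exact Hg]. split.
  { exact (inverse_Sym _ _ _ (inverse_sym _ _ _ Hg)). }
  exists k. intros x. apply (gauge_sym _ HR). rewrite <- (proj2 Hg x) at 2. apply Hk.
Qed.

Section WordGauge.
Variables (E : T -> T -> Prop) (c : nat -> T -> T).

(** Only the generators [c 0], ..., [c k] and their inverses are allowed in a step; this cap keeps
    balls finite although the family [c] is infinite. *)
Definition link k x y : Prop :=
  x = y \/ E x y \/ exists j, j <= k /\ (y = c j x \/ x = c j y).

Fixpoint path k n x y : Prop :=
  match n with
  | 0 => x = y
  | S n => exists z, link k x z /\ path k n z y
  end.

Lemma path_app k n m x y z : path k n x y -> path k m y z -> path k (n + m) x z.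
Proof.
  revert x. induction n as [|n IH]; simpl; intros x; [intros ->; auto|].
  intros [w [H1 H2]] H3. exists w. eauto.
Qed.

Lemma path_refl k n x : path k n x x.
Proof. induction n; simpl; [auto|]. exists x. split; [left|]; auto. Qed.

Lemma path_link_mono k k' n x y : k <= k' -> path k n x y -> path k' n x y.
Proof.
  intros Hk. revert x. induction n as [|n IH]; simpl; intros x; [auto|].
  intros [z [Hz H]]. exists z. split; [|auto].
  destruct Hz as [Hz|[Hz|[j [Hj Hz]]]]; [left; auto|right; left; auto|].
  right. right. exists j. split; [lia|auto].
Qed.

Lemma path_mono k k' n n' x y : k <= k' -> n <= n' -> path k n x y -> path k' n' x y.
Proof.
  intros Hk Hn H. apply (path_link_mono k k') in H; [|exact Hk].
  replace n' with (n + (n' - n)) by lia. eapply path_app; [exact H|apply path_refl].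
Qed.

Hypothesis Esym : forall x y, E x y -> E y x.

Lemma path_sym k n x y : path k n x y -> path k n y x.
Proof.
  revert x. induction n as [|n IH]; simpl; intros x; [auto|].
  intros [z [Hz H]]. change (path k (S n) y x). replace (S n) with (n + 1) by lia.
  apply (path_app _ _ _ _ z); [auto|]. exists x. split; [|reflexivity].
  destruct Hz as [Hz|[Hz|[j [Hj Hz]]]]; [left; auto|right; left; auto|].
  right. right. exists j. tauto.
Qed.

(** The radius bounds both the number of steps and the index of the generators, and both bounds
    survive concatenation. *)
Lemma word_gauge : gauge (fun k => path k k).
Proof.
  split.
  - intros k x. apply path_refl.
  - intros k x y. apply path_sym.
  - intros k m x y H. apply path_mono; auto.
  - intros k m x y z H1 H2. apply (path_app _ _ _ _ y).
    + apply (path_mono k _ k); auto; lia.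
    + apply (path_mono m _ m); auto; lia.
Qed.

Lemma word_gauge_relation x y : E x y -> path 1 1 x y.
Proof. intros H. exists y. split; [right; left; exact H|reflexivity]. Qed.

Lemma word_gauge_gen j x : path (S j) (S j) x (c j x).
Proof.
  apply (path_mono j _ 1); [lia|lia|]. exists (c j x). split; [|reflexivity].
  right. right. exists j. split; [lia|auto].
Qed.

Hypothesis cSym : forall j, Sym T (c j).

(** Apart from [E], a point is linked to itself, to [k + 1] images and to [k + 1] preimages. That
    this count does not depend on the point is what yields uniformly bounded balls. *)
Lemma link_cover k : exists F : T -> list T,
  (forall x, length (F x) <= S (S k + S k)) /\
  forall x y, link k x y -> E x y \/ In y (F x).
Proof.
  destruct (choice_fun _ _ (fun j g => inverse T (c j) g) cSym) as [ci Hci].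
  exists (fun x => x :: map (fun j => c j x) (seq 0 (S k)) ++ map (fun j => ci j x) (seq 0 (S k))).
  split.
  { intros x. cbn [length]. rewrite length_app, !length_map, !length_seq. lia. }
  intros x y [->|[H|[j [Hj H]]]]; [right; left; auto|auto|].
  right. right. apply in_or_app. destruct H as [->| ->]; [left|right]; apply in_map_iff; exists j.
  - split; [auto|]. apply in_seq. lia.
  - split; [apply (proj1 (Hci j))|]. apply in_seq. lia.
Qed.

Lemma word_gauge_locally_finite : (forall x, finite_set T (E x)) ->
  forall k n x, finite_set T (path k n x).
Proof.
  intros HE k. induction n as [|n IH]; intros x.
  { exists (x :: nil). simpl. auto. }
  destruct (link_cover k) as [F [_ HF]]. destruct (HE x) as [l Hl].
  destruct (finite_union T T (path k n) (l ++ F x)) as [l' Hl']; [auto|].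
  exists l'. intros y [z [Hz Hy]]. apply Hl'. exists z. split; [|exact Hy].
  apply in_or_app. destruct (HF x z Hz); auto.
Qed.

Lemma word_gauge_uniformly_finite b : (forall x, card_le T (E x) b) ->
  forall k n, exists m, forall x, card_le T (path k n x) m.
Proof.
  intros HE k. destruct (link_cover k) as [F [HFl HF]].
  induction n as [|n [m IH]].
  { exists 1. intros x. exists (x :: nil). simpl. auto. }
  destruct (choice_fun _ _ _ IH) as [B HB].
  exists ((b + S (S k + S k)) * m). intros x. destruct (HE x) as [l [Hll Hl]].
  exists (flat_map B (l ++ F x)). split.
  - assert (Hfm : forall r, length (flat_map B r) <= length r * m).
    { induction r as [|z r IHr]; simpl; [lia|]. rewrite length_app.
      pose proof (proj1 (HB z)). lia. }
    specialize (Hfm (l ++ F x)). rewrite length_app in Hfm. specialize (HFl x). nia.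
  - intros y [z [Hz Hy]]. apply in_flat_map. exists z. split.
    + apply in_or_app. destruct (HF x z Hz); auto.
    + apply HB, Hy.
Qed.
End WordGauge.
End Gauges.

Section Ladders.
Variable T : Type.
Implicit Types (f g h : T -> T) (x y z : T) (l : list T).

(* The points [d j 0, ..., d j j] form the [j]-th rung; values [d j a] with [j < a] are junk. *)
Definition ladder (d : nat -> nat -> T) : Prop :=
  forall j a j' a', a <= j -> a' <= j' -> d j a = d j' a' -> j = j' /\ a = a'.

Definition along (d : nat -> nat -> T) f : Prop :=
  (forall j a, a <= j -> exists a', a' <= j /\ f (d j a) = d j a') /\
  (forall z, (forall j a, a <= j -> z <> d j a) -> f z = z).

Definition rung_perm (d : nat -> nat -> T) f : Prop :=
  exists g, inverse T f g /\ along d f /\ along d g.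

Lemma rung_perm_Sym d f : rung_perm d f -> Sym T f.
Proof. intros [g [H _]]. exact (inverse_Sym _ _ _ H). Qed.
End Ladders.

(** * Bounded displacement and ladders *)

Section Levels.
Variables (T : Type) (e : nat -> T) (enc : T -> nat).
Hypotheses (e_enc : forall x, e (enc x) = x) (enc_e : forall n, enc (e n) = n).
Implicit Types (f g h : T -> T) (x y z : T) (l : list T).

Lemma enc_inj x y : enc x = enc y -> x = y.
Proof. intros H. rewrite <- (e_enc x), <- (e_enc y), H. reflexivity. Qed.

Lemma escape_list l : exists x, ~ In x l.
Proof.
  destruct (injective_escapes_list T e l) as [n Hn]; [|eauto].
  intros n m E. rewrite <- (enc_e n), <- (enc_e m), E. reflexivity.
Qed.

Lemma infinite_enc (P : T -> Prop) : (forall l, exists x, ~ In x l /\ P x) ->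
  forall N, exists k, N <= k /\ P (e k).
Proof.
  intros HP N. destruct (HP (map e (seq 0 N))) as [x [Hx Px]].
  exists (enc x). rewrite e_enc. split; [|exact Px].
  apply Nat.nlt_ge. intros Hlt. apply Hx. apply in_map_iff. exists (enc x).
  split; [apply e_enc|]. apply in_seq. lia.
Qed.

(* The complements of the domain and of the image are matched in increasing order. *)
Lemma extend_injection (P : T -> Prop) (v : T -> T) :
  (forall x y, P x -> P y -> v x = v y -> x = y) ->
  (forall l, exists x, ~ In x l /\ ~ P x) ->
  (forall l, exists y, ~ In y l /\ ~ (exists x, P x /\ v x = y)) ->
  exists u, Sym T u /\ forall x, P x -> u x = v x.
Proof.
  intros Hv HP HQ. set (Q := fun y => exists x, P x /\ v x = y).
  pose (rP := rank (fun k => ~ P (e k))). pose (rQ := rank (fun k => ~ Q (e k))).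
  assert (injP : forall x y, ~ P x -> ~ P y -> rP (enc x) = rP (enc y) -> x = y).
  { intros x y Hx Hy E. apply enc_inj, (rank_inj (fun k => ~ P (e k))); [| |exact E]; rewrite e_enc; auto. }
  assert (injQ : forall x y, ~ Q x -> ~ Q y -> rQ (enc x) = rQ (enc y) -> x = y).
  { intros x y Hx Hy E. apply enc_inj, (rank_inj (fun k => ~ Q (e k))); [| |exact E]; rewrite e_enc; auto. }
  assert (surP : forall n, exists x, ~ P x /\ rP (enc x) = n).
  { intros n. destruct (rank_surj _ (infinite_enc (fun x => ~ P x) HP) n) as [k [H1 H2]].
    exists (e k). rewrite enc_e. auto. }
  assert (surQ : forall n, exists x, ~ Q x /\ rQ (enc x) = n).
  { intros n. destruct (rank_surj _ (infinite_enc (fun x => ~ Q x) HQ) n) as [k [H1 H2]].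
    exists (e k). rewrite enc_e. auto. }
  destruct (bij_of_relation T T (fun x y => (P x /\ v x = y) \/
     (~ P x /\ ~ Q y /\ rP (enc x) = rQ (enc y)))) as [u [Su Hu]].
  - intros x. destruct (classic (P x)) as [Hx|Hx]; [eauto|].
    destruct (surQ (rP (enc x))) as [y [Hy E]]. exists y. auto.
  - intros y. destruct (classic (Q y)) as [[x Hx]|Hy]; [eauto|].
    destruct (surP (rQ (enc y))) as [x [Hx E]]. exists x. auto.
  - intros x y y' [[H1 H2]|[H1 [H2 H3]]] [[H1' H2']|[H1' [H2' H3']]]; try tauto; try congruence.
    apply injQ; congruence.
  - intros x x' y [[H1 H2]|[H1 [H2 H3]]] [[H1' H2']|[H1' [H2' H3']]].
    + apply Hv; congruence.
    + destruct H2'. exists x. auto.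
    + destruct H2. exists x'. auto.
    + apply injP; congruence.
  - exists u. split; [exact Su|]. intros x Hx. destruct (Hu x) as [[_ E]|[H _]]; [auto|tauto].
Qed.

Section Main.
Variable lev : T -> nat.
Hypotheses (lev_surj : forall n, exists x, lev x = n)
  (lev_finite : forall n, finite_set T (fun x => lev x <= n)).

Definition in2 n x : Prop := lev x = n \/ lev x = S n.

(** For fixed [r] the pairs of levels [4 i + r], [4 i + r + 1] are disjoint, so such a permutation
    acts independently on finite sets and fixes the two levels between consecutive pairs. *)
Definition layered r g : Prop :=
  Sym T g /\ forall x, g x <> x -> exists i, in2 (4 * i + r) x /\ in2 (4 * i + r) (g x).

Lemma layered_inverse r g h : layered r g -> inverse T g h -> layered r h.
Proof.
  intros [Sg Hg] Hi. split; [exact (inverse_Sym _ _ _ (inverse_sym _ _ _ Hi))|].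
  intros x Hx. destruct Hi as [H1 H2].
  destruct (Hg (h x)) as [i [Ha Hb]].
  { rewrite H2. auto. }
  rewrite H2 in Hb. exists i. auto.
Qed.

(** * Conjugating layered permutations into a rung group *)

Section Embed.
Variable d : nat -> nat -> T.
Hypothesis Hd : ladder T d.

(* The pair of levels [4 i + r, 4 i + r + 1] goes into rung [to_nat (i, N i)]; the levels
   [4 i + r + 2] and the rungs [to_nat (i, N i + 1)] leave infinite complements. *)
Lemma layered_conjugate r : exists u, Sym T u /\
  forall ui g, inverse T u ui -> layered r g -> along T d (fun z => u (g (ui z))).
Proof.
  assert (HN : forall n, exists N, forall x, lev x <= n -> enc x <= N).
  { intros n. destruct (lev_finite n) as [l Hl].
    destruct (list_max_bound T enc l) as [N HN]. exists N. auto. }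
  destruct (choice_fun _ _ _ HN) as [N0 HN0].
  (* [N i] bounds the codes of the points in the [i]-th pair of levels, so a code can serve as
     coordinate in any rung of index at least [N i]. *)
  pose (N := fun i => N0 (S (4 * i + r))).
  pose (idx := fun x => (lev x - r) / 4).
  assert (Hidx : forall i x, in2 (4 * i + r) x -> idx x = i /\ enc x <= N i).
  { intros i x Hx. split.
    - unfold idx. symmetry. apply (Nat.div_unique _ _ _ (lev x - r - 4 * i)); destruct Hx; lia.
    - apply HN0. destruct Hx; lia. }
  pose (P := fun x => exists i, in2 (4 * i + r) x).
  pose (v := fun x => d (to_nat (idx x, N (idx x))) (enc x)).
  assert (Hle : forall i m, m <= to_nat (i, m)).
  { intros i m. pose proof (to_nat_non_decreasing i m). lia. }
  destruct (extend_injection P v) as [u [Su Hu]].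
  - intros x y [i Hx] [i' Hy] E. destruct (Hidx i x Hx) as [<- Hx'].
    destruct (Hidx i' y Hy) as [<- Hy']. apply Hd in E.
    + apply enc_inj, E.
    + etransitivity; [exact Hx'|apply Hle].
    + etransitivity; [exact Hy'|apply Hle].
  - intros l. destruct (list_max_bound T lev l) as [M HM].
    destruct (lev_surj (4 * M + r + 2)) as [x Hx]. exists x. split.
    + intros H. apply HM in H. lia.
    + intros [i [H|H]]; lia.
  - intros l. destruct (injective_escapes_list T (fun i => d (to_nat (i, S (N i))) 0) l) as [i Hi].
    { intros n m E. apply Hd in E; [|lia|lia]. destruct E as [E _].
      apply to_nat_inj in E. congruence. }
    exists (d (to_nat (i, S (N i))) 0). split; [exact Hi|].
    intros [x [[i' Hx] E]]. destruct (Hidx i' x Hx) as [<- Hx']. unfold v in E.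
    apply Hd in E; [| |lia].
    + destruct E as [E _]. apply to_nat_inj in E. inversion E as [[E1 E2]]. subst i. lia.
    + etransitivity; [exact Hx'|apply Hle].
  - exists u. split; [exact Su|]. intros ui g [Hi1 Hi2] [Sg Hg].
    assert (Hz : forall z, g (ui z) <> ui z -> exists i a a', a <= to_nat (i, N i) /\
       a' <= to_nat (i, N i) /\ z = d (to_nat (i, N i)) a /\ u (g (ui z)) = d (to_nat (i, N i)) a').
    { intros z Hz. destruct (Hg _ Hz) as [i [Ha Hb]].
      exists i, (enc (ui z)), (enc (g (ui z))).
      destruct (Hidx _ _ Ha) as [Ea Ha']. destruct (Hidx _ _ Hb) as [Eb Hb'].
      split; [etransitivity; [exact Ha'|apply Hle]|].
      split; [etransitivity; [exact Hb'|apply Hle]|]. split.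
      - rewrite <- (Hi2 z) at 1. rewrite Hu by (exists i; auto). unfold v. rewrite Ea. auto.
      - rewrite Hu by (exists i; auto). unfold v. rewrite Eb. auto. }
    split.
    + intros j a Ha. destruct (classic (g (ui (d j a)) = ui (d j a))) as [E|E].
      { exists a. rewrite E, Hi2. auto. }
      destruct (Hz _ E) as [i [b [b' [Hb [Hb' [E1 E2]]]]]].
      apply Hd in E1; auto. destruct E1 as [-> ->]. exists b'. auto.
    + intros z Hzd. destruct (classic (g (ui z) = ui z)) as [E|E].
      { rewrite E, Hi2. auto. }
      destruct (Hz _ E) as [i [b [b' [Hb [Hb' [E1 E2]]]]]]. destruct (Hzd _ _ Hb E1).
Qed.

Lemma layered_generated : exists U, (forall u, In u U -> Sym T u) /\
  forall r g, r < 4 -> layered r g -> generated T (rung_perm T d) U g.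
Proof.
  destruct (choice_fun _ _ _ layered_conjugate) as [u Hu].
  exists (map u (seq 0 4)). split.
  { intros w Hw. apply in_map_iff in Hw. destruct Hw as [r [<- _]]. apply Hu. }
  intros r g Hr Hg H HH HGH HUH.
  destruct (Hu r) as [[ui Hui] Hc].
  assert (Hur : H (u r)). { apply HUH, in_map, in_seq. lia. }
  destruct (proj1 Hg) as [h Hh].
  assert (Hm : H (fun z => u r (g (ui z)))).
  { apply HGH. exists (fun z => u r (h (ui z))). split; [|split].
    - destruct Hui as [E1 E2], Hh as [E3 E4]. split; intros z.
      + rewrite E1, E3. apply E2.
      + rewrite E1, E4. apply E2.
    - apply Hc; auto.
    - apply Hc; [exact Hui|]. exact (layered_inverse _ _ _ Hg Hh). }
  pose proof (subgroup_inverse T H _ _ HH Hur Hui) as Hui'.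
  pose proof (subgroup_comp T H _ _ HH (subgroup_comp T H _ _ HH Hur Hm) Hui') as Hres.
  replace g with (fun x => ui (u r (g (ui (u r x))))); [exact Hres|].
  apply functional_extensionality. intros x. destruct Hui as [E1 E2]. rewrite !E1. reflexivity.
Qed.
End Embed.

(** * Generating bounded displacement from layered permutations *)

Section Generation.
Variable K : (T -> T) -> Prop.
Hypotheses (K_sub : is_subgroup T K)
  (K_layered : forall r g, r < 4 -> layered r g -> K g).

(** Since [g] preserves the label [c], sorting points by [c] modulo 4 splits [g] into four
    permutations with disjoint supports, each of them layered. *)
Lemma labelled_in (c : T -> nat) g : Sym T g -> (forall x, c (g x) = c x) ->
  (forall x, g x <> x -> in2 (c x) x) -> K g.
Proof.
  intros [h [Hg1 Hg2]] Hc H2.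
  assert (Hch : forall x, c (h x) = c x). { intros x. rewrite <- (Hg2 x) at 2. auto. }
  pose (gr := fun r x => if Nat.eq_dec (c x mod 4) r then g x else x).
  pose (hr := fun r x => if Nat.eq_dec (c x mod 4) r then h x else x).
  assert (HL : forall r, layered r (gr r)).
  { intros r. split.
    - exists (hr r). split; intros x; unfold gr, hr;
        destruct (Nat.eq_dec (c x mod 4) r) as [E|E].
      + rewrite Hc. destruct (Nat.eq_dec _ _); [apply Hg1|tauto].
      + destruct (Nat.eq_dec _ _); [tauto|reflexivity].
      + rewrite Hch. destruct (Nat.eq_dec _ _); [apply Hg2|tauto].
      + destruct (Nat.eq_dec _ _); [tauto|reflexivity].
    - intros x. unfold gr. destruct (Nat.eq_dec (c x mod 4) r) as [E|E]; [|tauto].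
      intros Hx. exists (c x / 4). pose proof (Nat.div_mod_eq (c x) 4) as Hdm.
      rewrite E in Hdm. rewrite <- Hdm. split; [auto|]. rewrite <- (Hc x) at 1.
      apply H2. intros E'. apply Hx. apply (f_equal h) in E'. rewrite !Hg1 in E'. exact E'. }
  assert (HK : forall r, r < 4 -> K (gr r)). { intros r Hr. apply (K_layered r); auto. }
  pose proof (subgroup_comp T K _ _ K_sub (HK 0 ltac:(lia)) (HK 1 ltac:(lia))) as H01.
  pose proof (subgroup_comp T K _ _ K_sub H01 (HK 2 ltac:(lia))) as H012.
  pose proof (subgroup_comp T K _ _ K_sub H012 (HK 3 ltac:(lia))) as H0123.
  replace g with (fun x => gr 3 (gr 2 (gr 1 (gr 0 x)))); [exact H0123|].
  apply functional_extensionality. intros x.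
  assert (Hin : forall r z, c z mod 4 = r -> gr r z = g z).
  { intros r z E. unfold gr. destruct (Nat.eq_dec _ _); tauto. }
  assert (Hout : forall r z, c z mod 4 <> r -> gr r z = z).
  { intros r z E. unfold gr. destruct (Nat.eq_dec _ _); tauto. }
  pose proof (Nat.mod_upper_bound (c x) 4 ltac:(lia)) as Hm.
  assert (Hcs : c x mod 4 = 0 \/ c x mod 4 = 1 \/ c x mod 4 = 2 \/ c x mod 4 = 3) by lia.
  destruct Hcs as [Ec|[Ec|[Ec|Ec]]].
  - rewrite (Hin 0) by auto. rewrite (Hout 1), (Hout 2), (Hout 3); rewrite ?Hc, ?Ec; auto.
  - rewrite (Hout 0), (Hin 1) by lia. rewrite (Hout 2), (Hout 3); rewrite ?Hc, ?Ec; auto.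
  - rewrite (Hout 0), (Hout 1), (Hin 2) by lia. rewrite (Hout 3); rewrite ?Hc, ?Ec; auto.
  - rewrite (Hout 0), (Hout 1), (Hout 2), (Hin 3) by lia. auto.
Qed.

Definition near f : Prop := forall x, lev (f x) <= S (lev x) /\ lev x <= S (lev (f x)).

(* The finite set of points of level at most [n] and its preimage under [f] have the same size. *)
Lemma crossing_lists f n : Sym T f -> near f -> exists la lb,
  NoDup la /\ NoDup lb /\ length la = length lb /\
  (forall x, In x la <-> lev x = n /\ lev (f x) = S n) /\
  (forall x, In x lb <-> lev x = S n /\ lev (f x) = n).
Proof.
  intros [g [Hg1 Hg2]] Hnear.
  destruct (finite_set_NoDup T _ (lev_finite n)) as [L [HL Hin]].
  pose (up := fun x => lev (f x) <=? n). pose (dn := fun x => lev x <=? n).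
  assert (HM : NoDup (map g L)).
  { apply NoDup_map_NoDup_ForallPairs; [|exact HL]. intros a b _ _ E.
    rewrite <- (Hg2 a), <- (Hg2 b), E. reflexivity. }
  assert (HinM : forall x, In x (map g L) <-> lev (f x) <= n).
  { intros x. rewrite in_map_iff. split.
    - intros [y [<- Hy]]. rewrite Hg2. apply Hin, Hy.
    - intros H. exists (f x). split; [apply Hg1|]. apply Hin, H. }
  exists (filter (fun x => negb (up x)) L), (filter (fun x => negb (dn x)) (map g L)).
  split; [apply NoDup_filter, HL|]. split; [apply NoDup_filter, HM|]. split; [|split].
  - pose proof (filter_length up L) as E1. pose proof (filter_length dn (map g L)) as E2.
    rewrite length_map in E2.
    assert (E3 : length (filter up L) = length (filter dn (map g L))).
    { apply Nat.le_antisymm; apply NoDup_incl_length; try (apply NoDup_filter; assumption);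
      intros x; rewrite !filter_In, HinM, Hin; unfold up, dn; rewrite !Nat.leb_le; tauto. }
    lia.
  - intros x. rewrite filter_In, Hin. unfold up. rewrite Bool.negb_true_iff, Nat.leb_gt.
    destruct (Hnear x). lia.
  - intros x. rewrite filter_In, HinM. unfold dn. rewrite Bool.negb_true_iff, Nat.leb_gt.
    destruct (Hnear x). lia.
Qed.

(** The involution [t] exchanges the points crossing up between two neighbouring levels with those
    crossing down, so [f] after [t] preserves levels. Each factor has an invariant label, as
    [labelled_in] requires. *)
Lemma near_in f : Sym T f -> near f -> K f.
Proof.
  intros Sf Hnear.
  destruct (choice_fun _ _ (fun n p => inverse T p p /\
    (forall x, lev x = n /\ lev (f x) = S n -> lev (p x) = S n /\ lev (f (p x)) = n) /\
    (forall x, lev x = S n /\ lev (f x) = n -> lev (p x) = n /\ lev (f (p x)) = S n) /\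
    (forall x, lev x = lev (f x) -> p x = x))) as [p Hp].
  { intros n. destruct (crossing_lists f n Sf Hnear) as [la [lb [Ha [Hb [El [Hia Hib]]]]]].
    destruct (exchange_lists T la lb Ha Hb El) as [p [Hp [H1 [H2 H3]]]].
    { intros x. rewrite Hia, Hib. lia. }
    exists p. split; [exact Hp|]. split; [|split].
    - intros x Hx. apply Hib, H1, Hia, Hx.
    - intros x Hx. apply Hia, H2, Hib, Hx.
    - intros x Hx. apply H3; rewrite ?Hia, ?Hib; lia. }
  (* The lower of the two levels names the boundary being crossed; it is the same for [x] and
     [t x]. *)
  pose (c := fun x => Nat.min (lev x) (lev (f x))).
  pose (t := fun x => p (c x) x).
  assert (Hall : forall x, lev (f (t x)) = lev x /\ c (t x) = c x).
  { intros x. unfold t. destruct (Hp (c x)) as [_ [H1 [H2 H3]]].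
    destruct (Hnear x) as [Hn1 Hn2].
    destruct (lt_eq_lt_dec (lev x) (lev (f x))) as [[Hl|Hl]|Hl].
    - destruct (H1 x) as [E1 E2]; unfold c in *; lia.
    - rewrite (H3 x Hl). auto.
    - destruct (H2 x) as [E1 E2]; unfold c in *; lia. }
  assert (Htt : forall x, t (t x) = x).
  { intros x. unfold t at 1. rewrite (proj2 (Hall x)). apply (Hp (c x)). }
  assert (St : Sym T t) by (exists t; split; exact Htt).
  assert (Kt : K t).
  { apply (labelled_in c); [exact St|apply Hall|].
    intros x _. destruct (Hnear x). unfold in2, c. lia. }
  assert (Kh : K (fun x => f (t x))).
  { apply (labelled_in lev).
    - apply Sym_comp; assumption.
    - apply Hall.
    - intros x _. left. reflexivity. }
  pose proof (subgroup_comp T K _ _ K_sub Kt Kh) as H.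
  replace f with (fun x => f (t (t x))); [exact H|].
  apply functional_extensionality. intros x. rewrite Htt. reflexivity.
Qed.

(** Transpositions within a level or between neighbouring levels are [near]; a longer one is a
    conjugate through a point [z] one level below [y]. *)
Lemma swap_in_levels m x y : lev x <= lev y -> lev y <= lev x + S m -> K (swap T x y).
Proof.
  revert x y. induction m as [|m IH]; intros x y Hxy Hm.
  - apply near_in; [exact (inverse_Sym _ _ _ (swap_inverse T x y))|].
    intros z. unfold swap. repeat destruct (excluded_middle_informative _); subst; lia.
  - destruct (Nat.eq_dec (lev y) (lev x + S (S m))) as [E|E]; [|apply IH; lia].
    destruct (lev_surj (lev x + S m)) as [z Hz].
    assert (Kxz : K (swap T x z)) by (apply IH; lia).
    assert (Kzy : K (swap T z y)) by (apply IH; lia).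
    pose proof (subgroup_comp T K _ _ K_sub (subgroup_comp T K _ _ K_sub Kzy Kxz) Kzy) as H.
    replace (swap T x y) with (fun w => swap T z y (swap T x z (swap T z y w))); [exact H|].
    apply functional_extensionality. intros w.
    apply swap_conj; intros ->; lia.
Qed.

Lemma swap_in x y : K (swap T x y).
Proof.
  destruct (Nat.le_ge_cases (lev x) (lev y)).
  - apply (swap_in_levels (lev y)); lia.
  - rewrite swap_comm. apply (swap_in_levels (lev x)); lia.
Qed.

Lemma finitary_correction f l : Sym T f -> exists s, K s /\
  (forall x, In x l -> s (f x) = x) /\
  (forall z, ~ In z l -> ~ In z (map f l) -> s z = z).
Proof.
  intros Sf. induction l as [|x l [s [Ks [Hs1 Hs2]]]].
  { exists (fun x => x). split; [apply K_sub|]. simpl. tauto. }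
  assert (Ss : Sym T s) by (apply K_sub, Ks).
  exists (fun z => swap T (s (f x)) x (s z)).
  split; [apply (subgroup_comp T K _ _ K_sub Ks (swap_in _ _))|]. split.
  - intros y [<-|Hy]; [apply swap_l|]. rewrite (Hs1 y Hy).
    destruct (classic (y = x)) as [->|E]; [rewrite (Hs1 x Hy); apply swap_l|].
    apply swap_other; [|exact E]. intros E'. apply E.
    apply (Sym_inj T f _ _ Sf), (Sym_inj T s _ _ Ss). rewrite (Hs1 y Hy). exact E'.
  - simpl. intros z Hz1 Hz2. rewrite (Hs2 z) by tauto. apply swap_other; [|intros E; apply Hz1; left; auto].
    intros E. apply Hz2. left. apply (Sym_inj T s _ _ Ss). rewrite <- E. symmetry. apply (Hs2 z); tauto.
Qed.

Variable R : nat -> T -> T -> Prop.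
Hypotheses (HR : gauge T R)
  (lev_step : forall n x y, lev x < n -> R n x y -> lev y <= n).

(** Above level [k], a displacement of at most [k] changes the level by at most one. The finitely
    many points at or below level [k] are made fixed points by a finitary correction [s]. *)
Lemma bounded_displacement_in f : bounded_displacement T R f -> K f.
Proof.
  intros [Sf [k Hk]].
  assert (Hlow : forall x, lev x <= k -> lev (f x) <= S k).
  { intros x Hx. apply (lev_step _ x); [lia|]. apply (gauge_mono _ _ HR k); auto. }
  assert (Hup : forall x, k < lev x -> lev (f x) <= S (lev x) /\ lev x <= S (lev (f x))).
  { intros x Hx. split.
    - apply (lev_step _ x); [lia|]. apply (gauge_mono _ _ HR k); [lia|auto].
    - assert (Hfx : k <= lev (f x)).
      { apply Nat.nlt_ge. intros H.
        apply (lev_step _ _ x) in H; [lia|]. apply (gauge_sym _ _ HR), Hk. }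
      apply (lev_step _ (f x)); [lia|]. apply (gauge_mono _ _ HR k); [lia|].
      apply (gauge_sym _ _ HR), Hk. }
  destruct (finite_set_NoDup T _ (lev_finite k)) as [l [_ Hl]].
  destruct (finitary_correction f l Sf) as [s [Ks [Hs1 Hs2]]].
  assert (Ss : Sym T s) by (apply K_sub, Ks).
  assert (Ssf : Sym T (fun x => s (f x))) by (apply Sym_comp; assumption).
  assert (Kf' : K (fun x => s (f x))).
  { apply near_in; [exact Ssf|]. intros x.
    destruct (Nat.le_gt_cases (lev x) k) as [Hx|Hx].
    { rewrite Hs1 by (apply Hl, Hx). lia. }
    assert (Hfl : ~ In (f x) (map f l)).
    { intros H. apply in_map_iff in H. destruct H as [y [E Hy]].
      apply (Sym_inj T f _ _ Sf) in E. subst y. apply Hl in Hy. lia. }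
    (* Suppose [f x] has level at most [k]. Levels up to [k] are filled by fixed points of the
       corrected map, and [s] moves only points of level at most [k + 1], so [x] and [s (f x)] both
       have level exactly [k + 1]. *)
    destruct (Nat.le_gt_cases (lev (f x)) k) as [Hfx|Hfx].
    2: { rewrite Hs2; [apply Hup, Hx| |exact Hfl]. rewrite Hl. lia. }
    pose proof (Hup x Hx) as Hx'.
    assert (Hz1 : k < lev (s (f x))).
    { apply Nat.nle_gt. intros H. apply Hl in H. pose proof (Hs1 _ H) as E.
      apply (Sym_inj T _ _ _ Ssf) in E. rewrite E in H. apply Hl in H. lia. }
    assert (Hz2 : lev (s (f x)) <= S k).
    { destruct (classic (In (s (f x)) (map f l))) as [H|H].
      - apply in_map_iff in H. destruct H as [y [<- Hy]]. apply Hlow, Hl, Hy.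
      - assert (E : s (s (f x)) = s (f x)).
        { apply Hs2; [|exact H]. rewrite Hl. lia. }
        apply (Sym_inj T s _ _ Ss) in E. rewrite E. lia. }
    lia. }
  destruct Ss as [si Hsi].
  pose proof (subgroup_comp T K _ _ K_sub Kf' (subgroup_inverse T K _ _ K_sub Ks Hsi)) as H.
  replace f with (fun x => si (s (f x))); [exact H|].
  apply functional_extensionality. intros x. apply (proj1 Hsi).
Qed.
End Generation.
End Main.

(** Exhaustion by finite sets [J n], each swallowing the balls around the points of the previous one
    and adding a fresh point, so that no level is empty; [lev x] is the stage at which [x]
    enters. *)
Lemma levels_exist R : (forall k x, finite_set T (R k x)) -> exists lev : T -> nat,
  (forall n, exists x, lev x = n) /\ (forall n, finite_set T (fun x => lev x <= n)) /\
  (forall n x y, lev x < n -> R n x y -> lev y <= n).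
Proof.
  intros HR.
  (* [dependent_choice] hides the first term, so the invariant carries the emptiness of [J 0]. *)
  destruct (dependent_choice (list T) (fun n l => n = 0 -> l = nil) (fun n l l' => incl l l' /\ In (e n) l' /\
    (forall x y, In x l -> R n x y -> In y l') /\ exists z, In z l' /\ ~ In z l) nil)
    as [J HJ]; [auto| |].
  { intros n l _. destruct (finite_union T T (R n) l) as [b Hb]; [auto|].
    destruct (escape_list l) as [z Hz]. exists (e n :: z :: b ++ l). split; [discriminate|].
    split; [intros w Hw; right; right; apply in_or_app; auto|]. split; [left; auto|]. split.
    - intros x y Hx Hxy. right. right. apply in_or_app. left. apply Hb. eauto.
    - exists z. simpl. auto. }
  assert (Hmono : forall n m, n <= m -> incl (J n) (J m)).
  { induction 1 as [|m _ IH]; [apply incl_refl|].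
    eapply incl_tran; [exact IH|]. apply HJ. }
  destruct (choice_fun T nat (fun x n => In x (J (S n)) /\ ~ In x (J n))) as [lev Hlev].
  { intros x. assert (Hx : In x (J (S (enc x)))).
    { rewrite <- (e_enc x) at 1. apply HJ. }
    revert Hx. generalize (enc x). induction n as [|n IH]; intros Hx.
    - exists 0. split; [exact Hx|]. rewrite (proj1 (HJ 0) eq_refl). auto.
    - destruct (classic (In x (J (S n)))) as [H|H]; [auto|]. exists (S n). auto. }
  assert (Hle : forall n x, In x (J (S n)) <-> lev x <= n).
  { intros n x. destruct (Hlev x) as [H1 H2]. split; intros H.
    - apply Nat.nlt_ge. intros Hlt. apply H2. apply (Hmono (S n)); auto.
    - apply (Hmono (S (lev x))); [lia|auto]. }
  exists lev. split; [|split].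
  - intros n. destruct (HJ n) as [_ [_ [_ [_ [z [Hz1 Hz2]]]]]]. exists z.
    apply Hle in Hz1. destruct n as [|n]; [lia|]. rewrite Hle in Hz2. lia.
  - intros n. exists (J (S n)). intros x. apply Hle.
  - intros [|n] x y Hx Hxy; [lia|]. apply Hle. destruct (HJ (S n)) as [_ [_ [_ [H _]]]].
    apply (H x); [|exact Hxy]. apply Hle. lia.
Qed.

Lemma bounded_displacement_preceq R d : gauge T R -> (forall k x, finite_set T (R k x)) ->
  ladder T d -> preceq T (bounded_displacement T R) (rung_perm T d).
Proof.
  intros HR HF Hd. destruct (levels_exist R HF) as [lev [H1 [H2 H3]]].
  destruct (layered_generated lev H1 H2 d Hd) as [U [HU HL]].
  exists U. split; [exact HU|]. intros f Hf.
  apply (bounded_displacement_in lev H1 H2 (generated T (rung_perm T d) U)) with (R := R); auto.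
  apply generated_subgroup; [|exact HU]. apply rung_perm_Sym.
Qed.
End Levels.

(** * Limits in closed subgroups *)

Section Closed.
Variables (T : Type) (e : nat -> T) (enc : T -> nat).
Hypotheses (e_enc : forall x, e (enc x) = x) (enc_e : forall n, enc (e n) = n).
Variable G : (T -> T) -> Prop.
Hypotheses (HG : is_subgroup T G) (HGc : closed_in_S T G).
Implicit Types (f g h : T -> T) (x y z : T) (l : list T).

Lemma closed_limit (Gamma : nat -> list T) (g : nat -> T -> T) :
  (forall k, G (g k)) -> (forall k, incl (Gamma k) (Gamma (S k))) ->
  (forall k x, In x (Gamma k) -> g (S k) x = g k x) ->
  (forall k, In (e k) (Gamma (S k))) ->
  (forall k, exists y, In y (Gamma (S k)) /\ g (S k) y = e k) ->
  exists f, G f /\ forall k x, In x (Gamma k) -> f x = g k x.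
Proof.
  intros Gg Hinc Hag Hdom Hran.
  assert (Hmono : forall k m, k <= m -> incl (Gamma k) (Gamma m)).
  { induction 1 as [|m _ IH]; [apply incl_refl|]. eapply incl_tran; [exact IH|apply Hinc]. }
  assert (Hstab : forall k m x, k <= m -> In x (Gamma k) -> g m x = g k x).
  { induction 1 as [|m Hm IH]; [auto|]. intros Hx. rewrite Hag; auto.
    apply (Hmono k); auto. }
  assert (Hsame : forall k m x, In x (Gamma k) -> In x (Gamma m) -> g k x = g m x).
  { intros k m x H1 H2. destruct (Nat.le_ge_cases k m).
    - symmetry. apply Hstab; auto.
    - apply Hstab; auto. }
  destruct (bij_of_relation T T (fun x y => exists k, In x (Gamma k) /\ g k x = y))
    as [f [Sf Hf]].
  - intros x. exists (g (S (enc x)) x), (S (enc x)). split; [|reflexivity].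
    rewrite <- (e_enc x) at 1. apply Hdom.
  - intros y. destruct (Hran (enc y)) as [x [H1 H2]]. rewrite e_enc in H2. eauto.
  - intros x y y' [k [Hk <-]] [m [Hm <-]]. apply Hsame; auto.
  - intros x x' y [k [Hk Ek]] [m [Hm Em]].
    apply (Sym_inj T (g (k + m))); [apply HG, Gg|].
    rewrite (Hstab k _ x), (Hstab m _ x'); auto; try lia. congruence.
  - assert (Hfk : forall k x, In x (Gamma k) -> f x = g k x).
    { intros k x Hx. destruct (Hf x) as [m [Hm <-]]. apply Hsame; auto. }
    exists f. split; [|exact Hfk]. apply HGc; [exact Sf|]. intros l.
    destruct (list_max_bound T enc l) as [N HN]. exists (g (S N)). split; [apply Gg|].
    intros x Hx. symmetry. apply Hfk. apply (Hmono (S (enc x))).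
    + specialize (HN x Hx). lia.
    + rewrite <- (e_enc x) at 1. apply Hdom.
Qed.

(** If every pointwise stabilizer had an infinite orbit, stage [k] could be altered by a stabilizing
    element to carry some point out of its [k]-ball; the limit would exceed every displacement
    bound. *)
Lemma finite_orbits_of_bounded_displacement R : (forall k x, finite_set T (R k x)) ->
  subset T G (bounded_displacement T R) ->
  exists Gamma, all_orbits_finite T (pstab T G Gamma).
Proof.
  intros HR HGR. apply NNPP. intros Hn.
  assert (Hinf : forall Gamma, exists x, ~ finite_set T (orbit T (pstab T G Gamma) x)).
  { intros Gamma. apply not_all_ex_not. intros H. apply Hn. exists Gamma. exact H. }
  destruct (dependent_choice (list T * (T -> T)) (fun _ st => G (snd st))
    (fun k st st' => incl (fst st) (fst st') /\
       (forall x, In x (fst st) -> snd st' x = snd st x) /\ In (e k) (fst st') /\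
       (exists y, In y (fst st') /\ snd st' y = e k) /\
       (exists x, In x (fst st') /\ ~ R k x (snd st' x)))
    (nil, fun x => x)) as [st Hst].
  - exact (proj1 (proj2 HG)).
  - intros k [Gamma g] Gg. simpl in Gg. destruct (Hinf Gamma) as [x Hx].
    destruct (proj1 HG g Gg) as [gi [Hg1 Hg2]]. destruct (HR k x) as [b Hb].
    (* Otherwise the orbit of [x] would lie in the preimage of the finite list [b] under [g]. *)
    assert (Hh : exists h, pstab T G Gamma h /\ ~ In (g (h x)) b).
    { apply NNPP. intros Hnh. apply Hx. exists (map gi b). intros y [h [Hh <-]].
      rewrite <- (Hg1 (h x)). apply in_map, NNPP. intros H. apply Hnh. eauto. }
    destruct Hh as [h [[Gh Hh1] Hh2]].
    assert (Ggh : G (fun z => g (h z))) by (apply (subgroup_comp T G h g HG); auto).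
    destruct (proj1 HG _ Ggh) as [gh [_ Hgh]].
    exists (x :: e k :: gh (e k) :: Gamma, fun z => g (h z)). simpl.
    split; [exact Ggh|]. split; [intros z Hz; simpl; auto|]. split.
    { intros z Hz. rewrite Hh1; auto. }
    split; [auto|]. split; [exists (gh (e k)); auto|]. exists x. auto.
  - destruct (closed_limit (fun k => fst (st k)) (fun k => snd (st k))) as [f [Gf Hf]];
      try (intros k; destruct (Hst k) as [H1 [H2 [H3 [H4 [H5 H6]]]]]; assumption).
    destruct (HGR f Gf) as [_ [k Hk]].
    destruct (Hst k) as [_ [_ [_ [_ [_ [x [Hx Hnx]]]]]]]. apply Hnx.
    rewrite <- (Hf (S k) x Hx). apply Hk.
Qed.

(** * Closed subgroups with large orbits *)

Section Tree.
Hypothesis big : forall Gamma n, exists x, ~ card_le T (orbit T (pstab T G Gamma) x) n.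
Variables (A : Type) (alph : nat -> list A).

(** Words carry their newest letter first, so [tl] gives the parent of a node. *)
Fixpoint strs k : list (list A) :=
  match k with
  | 0 => nil :: nil
  | S k => flat_map (fun w => map (fun a => a :: w) (alph k)) (strs k)
  end.

Fixpoint str (s : nat -> A) k : list A :=
  match k with
  | 0 => nil
  | S k => s k :: str s k
  end.

Lemma strs_S k i : In i (strs (S k)) <-> exists a w, i = a :: w /\ In a (alph k) /\ In w (strs k).
Proof.
  simpl. rewrite in_flat_map. split.
  - intros [w [Hw H]]. apply in_map_iff in H. destruct H as [a [<- Ha]]. eauto.
  - intros [a [w [-> [Ha Hw]]]]. exists w. split; [exact Hw|]. apply in_map_iff. eauto.
Qed.

Lemma strs_length k w : In w (strs k) -> length w = k.
Proof.
  revert w. induction k as [|k IH]; intros w.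
  - intros [<-|[]]. reflexivity.
  - rewrite strs_S. intros [a [v [-> [_ Hv]]]]. simpl. rewrite IH; auto.
Qed.

Lemma str_in s k : (forall k, In (s k) (alph k)) -> In (str s k) (strs k).
Proof.
  intros Hs. induction k as [|k IH]; [left; auto|]. apply strs_S. exists (s k), (str s k). auto.
Qed.

(* [gam w] realizes the word [w]; [used] holds the points already taken as values. *)
Record stage := { fixed : list T; used : list T; root : T; gam : list A -> T -> T }.

(** Avoiding [used], together with injectivity within a stage, makes all root values of the tree
    distinct. The clauses on [e k] feed [closed_limit]. *)
Definition stage_step k (s s' : stage) : Prop :=
  incl (fixed s) (fixed s') /\ incl (used s) (used s') /\ In (e k) (fixed s') /\
  In (root s') (fixed s') /\
  (forall i, In i (strs (S k)) ->
    (forall z, In z (fixed s) -> gam s' i z = gam s (tl i) z) /\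
    (exists y, In y (fixed s') /\ gam s' i y = e k) /\
    ~ In (gam s' i (root s')) (used s) /\ In (gam s' i (root s')) (used s')) /\
  (forall i j, In i (strs (S k)) -> In j (strs (S k)) ->
    gam s' i (root s') = gam s' j (root s') -> i = j).

Lemma stage_extend k s : (forall w, In w (strs k) -> G (gam s w)) ->
  exists s', (forall w, In w (strs (S k)) -> G (gam s' w)) /\ stage_step k s s'.
Proof.
  intros Hs. set (items := strs (S k)).
  assert (Htl : forall i, In i items -> G (gam s (tl i))).
  { intros i Hi. apply strs_S in Hi. destruct Hi as [a [w [-> [_ Hw]]]]. apply Hs, Hw. }
  destruct (big (fixed s) (length (used s) + length items)) as [x Hx].
  destruct (distinct_representatives T (e 0) (list A) items
    (fun i y => exists h, pstab T G (fixed s) h /\ gam s (tl i) (h x) = y)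
    (used s) (length (used s) + length items)) as [b [Hb Hbi]].
  { intros i Hi [l [Hl Hl']]. apply Hx.
    destruct (proj1 HG _ (Htl i Hi)) as [gi [Hg1 _]].
    exists (map gi l). rewrite length_map. split; [exact Hl|].
    intros y [h [Hh <-]]. rewrite <- (Hg1 (h x)). apply in_map, Hl'. eauto. }
  { lia. }
  destruct (choice_fun _ _ (fun i h => In i items ->
    pstab T G (fixed s) h /\ gam s (tl i) (h x) = b i)) as [h Hh].
  { intros i. destruct (classic (In i items)) as [Hi|Hi].
    - destruct (proj1 (Hb i Hi)) as [h Hh]. exists h. auto.
    - exists (fun z => z). tauto. }
  pose (g := fun i z => gam s (tl i) (h i z)).
  assert (Gg : forall i, In i items -> G (g i)).
  { intros i Hi. apply (subgroup_comp T G (h i)); [exact HG| |auto]. apply (Hh i Hi). }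
  destruct (choice_fun _ _ (fun i y => In i items -> g i y = e k)) as [yy Hy].
  { intros i. destruct (classic (In i items)) as [Hi|Hi].
    - destruct (proj1 HG _ (Gg i Hi)) as [gi [_ Hgi]]. exists (gi (e k)). auto.
    - exists (e 0). tauto. }
  assert (Hgx : forall i, In i items -> g i x = b i) by (intros i Hi; apply (Hh i Hi)).
  exists {| fixed := x :: e k :: fixed s ++ map yy items;
            used := map b items ++ used s; root := x; gam := g |}.
  split; [exact Gg|]. repeat split; simpl.
  - intros z Hz. right. right. apply in_or_app. auto.
  - intros z Hz. apply in_or_app. auto.
  - auto.
  - auto.
  - intros z Hz. unfold g. f_equal. apply (Hh i H), Hz.
  - exists (yy i). split; [|apply Hy, H]. right. right. apply in_or_app. right. apply in_map, H.
  - rewrite Hgx by exact H. apply (Hb i H).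
  - rewrite Hgx by exact H. apply in_or_app. left. apply in_map, H.
  - intros i j Hi Hj. rewrite !Hgx by assumption. apply Hbi; assumption.
Qed.

Lemma tree_of_translates : exists (x : nat -> T) (b : list A -> T),
  (forall k m i j, In i (strs (S k)) -> In j (strs (S m)) -> b i = b j -> i = j) /\
  (forall s, (forall k, In (s k) (alph k)) ->
     exists g, G g /\ forall k, g (x k) = b (str s (S k))).
Proof.
  destruct (dependent_choice stage (fun k s => forall w, In w (strs k) -> G (gam s w)) stage_step
    {| fixed := nil; used := nil; root := e 0; gam := fun _ z => z |}) as [st Hst].
  { intros w _. exact (proj1 (proj2 HG)). }
  { apply stage_extend. }
  assert (Hused : forall k m, k <= m -> incl (used (st k)) (used (st m))).
  { induction 1 as [|m _ IH]; [apply incl_refl|]. eapply incl_tran; [exact IH|apply Hst]. }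
  pose (x := fun k => root (st (S k))).
  pose (b := fun i => gam (st (length i)) i (root (st (length i)))).
  assert (Hb : forall k i, In i (strs (S k)) -> b i = gam (st (S k)) i (x k)).
  { intros k i Hi. unfold b, x. rewrite (strs_length _ _ Hi). reflexivity. }
  assert (Hlt : forall k m i j, k < m -> In i (strs (S k)) -> In j (strs (S m)) -> b i <> b j).
  { intros k m i j Hkm Hi Hj E. rewrite (Hb k i Hi), (Hb m j Hj) in E.
    destruct (Hst k) as [_ [_ [_ [_ [_ [Hk _]]]]]]. destruct (Hk i Hi) as [_ [_ [_ Hk']]].
    destruct (Hst m) as [_ [_ [_ [_ [_ [Hm _]]]]]]. destruct (Hm j Hj) as [_ [_ [Hm' _]]].
    apply Hm'. fold (x m). rewrite <- E. apply (Hused (S k)); [lia|exact Hk']. }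
  exists x, b. split.
  - intros k m i j Hi Hj E. destruct (lt_eq_lt_dec k m) as [[H|H]|H].
    + destruct (Hlt k m i j H Hi Hj E).
    + subst m. rewrite (Hb k i Hi), (Hb k j Hj) in E. apply (Hst k); auto.
    + destruct (Hlt m k j i H Hj Hi (eq_sym E)).
  - intros s Hs.
    assert (Hin : forall k, In (str s k) (strs k)) by (intros k; apply str_in, Hs).
    destruct (closed_limit (fun k => fixed (st k)) (fun k => gam (st k) (str s k)))
      as [g [Gg Hg]].
    + intros k. apply Hst, Hin.
    + intros k. apply Hst.
    + intros k z Hz. destruct (Hst k) as [_ [_ [_ [_ [_ [Hk _]]]]]].
      apply (Hk (str s (S k)) (Hin (S k))), Hz.
    + intros k. apply Hst.
    + intros k. destruct (Hst k) as [_ [_ [_ [_ [_ [Hk _]]]]]].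
      apply (Hk (str s (S k)) (Hin (S k))).
    + exists g. split; [exact Gg|]. intros k. rewrite (Hb k) by apply Hin.
      apply Hg. apply Hst.
Qed.
End Tree.
End Closed.

(* The blocks of [nat] are the fibres of the integer square root. *)
Definition block_perm (f fi : nat -> nat) : Prop :=
  inverse nat f fi /\ forall t, Nat.sqrt (f t) = Nat.sqrt t.

Lemma block_perm_sym f fi : block_perm f fi -> block_perm fi f.
Proof.
  intros [[H1 H2] H3]. split; [split; auto|]. intros t. rewrite <- (H2 t) at 2. auto.
Qed.

(** * Block permutations encoded as branches of a finitely branching tree *)

Definition agree q (f f' : nat -> nat) : Prop := forall u, Nat.sqrt u <= q -> f u = f' u.

Lemma agree_inverse q f fi f' fi' : block_perm f fi -> block_perm f' fi' ->
  agree q f f' -> agree q fi fi'.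
Proof.
  intros Hf Hf' Ha u Hu. pose proof (block_perm_sym _ _ Hf) as [_ Hs].
  destruct Hf as [[H1 H2] _], Hf' as [[H1' H2'] _].
  rewrite <- (H2 u) at 2. rewrite Ha by (rewrite Hs; exact Hu). symmetry. apply H1'.
Qed.

(** The letter at [t] records [f] on all blocks up to that of [t], which end just before
    [(sqrt t + 1)^2]. For a block permutation, whole blocks also determine the inverse there. *)
Definition restriction (f : nat -> nat) t : list nat :=
  map f (seq 0 (S (Nat.sqrt t) * S (Nat.sqrt t))).

Lemma sqrt_le_lt u q : Nat.sqrt u <= q <-> u < S q * S q.
Proof.
  pose proof (Nat.sqrt_spec u ltac:(lia)) as [H1 H2]. split; intros H.
  - nia.
  - apply Nat.lt_succ_r. apply Nat.sqrt_lt_square. exact H.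
Qed.

Lemma restriction_eq f f' t : restriction f t = restriction f' t <-> agree (Nat.sqrt t) f f'.
Proof.
  unfold restriction. split.
  - intros H u Hu. apply (ext_in_map H). apply in_seq.
    apply sqrt_le_lt in Hu. lia.
  - intros H. apply map_ext_in. intros u Hu. apply in_seq in Hu. apply H, sqrt_le_lt. lia.
Qed.

(** Each letter contains the information of the earlier ones, so the newest letter and the length
    decide equality. *)
Lemma str_restriction_eq f f' t m :
  str (list nat) (restriction f) (S t) = str (list nat) (restriction f') (S m) <->
  t = m /\ agree (Nat.sqrt t) f f'.
Proof.
  assert (Hlen : forall (s : nat -> list nat) k, length (str _ s k) = k).
  { intros s. induction k; simpl; auto. }
  split.
  - intros H. assert (E : t = m).
    { apply (f_equal (@length _)) in H. rewrite !Hlen in H. lia. }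
    subst m. split; [reflexivity|]. apply restriction_eq. exact (f_equal (hd nil) H).
  - intros [<- H].
    assert (Hk : forall k, k <= S t ->
      str (list nat) (restriction f) k = str (list nat) (restriction f') k).
    { induction k as [|k IH]; intros Hk; [reflexivity|]. simpl. f_equal; [|apply IH; lia].
      apply restriction_eq. intros u Hu. apply H. etransitivity; [exact Hu|].
      apply Nat.sqrt_le_mono. lia. }
    apply Hk. lia.
Qed.

Definition restrictions t : list (list nat) :=
  strs nat (fun _ => seq 0 (S (Nat.sqrt t) * S (Nat.sqrt t))) (S (Nat.sqrt t) * S (Nat.sqrt t)).

Lemma map_in_strs (A B : Type) (f : B -> A) (l : list B) (al : list A) :
  (forall x, In x l -> In (f x) al) -> In (map f l) (strs A (fun _ => al) (length l)).
Proof.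
  induction l as [|x l IH]; intros H; [left; reflexivity|].
  apply strs_S. exists (f x), (map f l). split; [reflexivity|]. split.
  - apply H. left. reflexivity.
  - apply IH. intros y Hy. apply H. right. exact Hy.
Qed.

Lemma restriction_in f fi t : block_perm f fi -> In (restriction f t) (restrictions t).
Proof.
  intros [_ H]. unfold restriction, restrictions.
  set (m := S (Nat.sqrt t) * S (Nat.sqrt t)).
  pose proof (map_in_strs nat nat f (seq 0 m) (seq 0 m)) as Hs. rewrite length_seq in Hs.
  apply Hs. intros x Hx.
  apply in_seq in Hx. apply in_seq. split; [lia|]. unfold m in *. simpl. apply sqrt_le_lt.
  rewrite H. apply sqrt_le_lt. lia.
Qed.

(* [zcode] lists the integers as 0, -1, 1, -2, 2, ...: nonnegative ones get even codes. *)
Definition zcode (i : Z) : nat :=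
  if (0 <=? i)%Z then 2 * Z.to_nat i else 2 * Z.to_nat (- i) - 1.

Lemma zcode_inj i i' : zcode i = zcode i' -> i = i'.
Proof. unfold zcode. destruct (Z.leb_spec 0 i), (Z.leb_spec 0 i'); lia. Qed.

Lemma zcode_even i : Nat.even (zcode i) = (0 <=? i)%Z.
Proof.
  unfold zcode. destruct (Z.leb_spec 0 i).
  - rewrite Nat.even_mul. reflexivity.
  - replace (2 * Z.to_nat (- i) - 1) with (S (2 * (Z.to_nat (- i) - 1))) by lia.
    rewrite Nat.even_succ, Nat.odd_mul. reflexivity.
Qed.

(** Copy [i] of rung [j] lies in the block of index [to_nat (j, zcode i)]. The index is at least
    [j], and block [b] has [2 b + 1] places, so the [j + 1] coordinates fit. *)
Definition position j (i : Z) a : nat := to_nat (j, zcode i) * to_nat (j, zcode i) + a.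

Lemma sqrt_square_add b a : a <= 2 * b -> Nat.sqrt (b * b + a) = b.
Proof. intros H. apply Nat.sqrt_unique. lia. Qed.

Lemma first_le_to_nat j n : j <= to_nat (j, n).
Proof. pose proof (to_nat_non_decreasing j n). lia. Qed.

Lemma position_inj j i a j' i' a' : a <= j -> a' <= j' ->
  position j i a = position j' i' a' -> j = j' /\ i = i' /\ a = a'.
Proof.
  unfold position. intros Ha Ha' E.
  pose proof (first_le_to_nat j (zcode i)). pose proof (first_le_to_nat j' (zcode i')).
  assert (Eb : to_nat (j, zcode i) = to_nat (j', zcode i')).
  { rewrite <- (sqrt_square_add (to_nat (j, zcode i)) a) by lia. rewrite E.
    apply sqrt_square_add. lia. }
  rewrite Eb in E. apply to_nat_inj in Eb. inversion Eb as [[Ej Ei]].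
  apply zcode_inj in Ei. repeat split; auto. lia.
Qed.

(* Applies [p j] in coordinate [a] of the block with index [to_nat (j, n)], for [n] even. *)
Definition half_line_perm (p : nat -> nat -> nat) t : nat :=
  let b := Nat.sqrt t in let a := t - b * b in let (j, n) := of_nat b in
  if ((a <=? j) && Nat.even n)%bool then b * b + p j a else t.

Lemma half_line_perm_at p j n a : a <= j ->
  half_line_perm p (to_nat (j, n) * to_nat (j, n) + a) =
  to_nat (j, n) * to_nat (j, n) + if Nat.even n then p j a else a.
Proof.
  intros Ha. unfold half_line_perm. pose proof (first_le_to_nat j n) as Hj.
  rewrite sqrt_square_add by lia. rewrite cancel_of_to.
  rewrite Nat.add_comm, Nat.add_sub, (proj2 (Nat.leb_le a j) Ha).
  destruct (Nat.even n); simpl; lia.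
Qed.

Lemma half_line_perm_cases p t :
  half_line_perm p t = t \/
  exists j n a, a <= j /\ Nat.even n = true /\ t = to_nat (j, n) * to_nat (j, n) + a.
Proof.
  unfold half_line_perm. destruct (of_nat (Nat.sqrt t)) as [j n] eqn:E.
  destruct (Nat.leb_spec (t - Nat.sqrt t * Nat.sqrt t) j) as [Ha|Ha]; [|auto].
  destruct (Nat.even n) eqn:En; [|auto]. right.
  exists j, n, (t - Nat.sqrt t * Nat.sqrt t). repeat split; auto.
  rewrite <- E, cancel_to_of. pose proof (Nat.sqrt_spec t ltac:(lia)). lia.
Qed.

Lemma half_line_perm_cancel p q :
  (forall j a, a <= j -> p j a <= j) -> (forall j a, a <= j -> q j (p j a) = a) ->
  forall t, half_line_perm q (half_line_perm p t) = t.
Proof.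
  intros Hp Hqp t.
  assert (Hcase : (exists j n a, a <= j /\ Nat.even n = true /\
    t = to_nat (j, n) * to_nat (j, n) + a) \/ forall r, half_line_perm r t = t).
  { destruct (classic (exists j n a, a <= j /\ Nat.even n = true /\
      t = to_nat (j, n) * to_nat (j, n) + a)) as [H|H]; [auto|].
    right. intros r. destruct (half_line_perm_cases r t); tauto. }
  destruct Hcase as [[j [n [a [Ha [En ->]]]]]|H].
  - rewrite half_line_perm_at, En by auto. rewrite half_line_perm_at, En by auto.
    rewrite Hqp; auto.
  - rewrite !H. reflexivity.
Qed.

Lemma half_line_perm_block p t : (forall j a, a <= j -> p j a <= j) ->
  Nat.sqrt (half_line_perm p t) = Nat.sqrt t.
Proof.
  intros Hp. destruct (half_line_perm_cases p t) as [->|[j [n [a [Ha [En ->]]]]]]; [auto|].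
  rewrite half_line_perm_at, En by auto.
  pose proof (first_le_to_nat j n). specialize (Hp j a Ha).
  rewrite !sqrt_square_add by lia. reflexivity.
Qed.

(** * Recovering a rung group from a closed group with large orbits *)

Section LargeOrbits.
Variables (T : Type) (e : nat -> T) (enc : T -> nat).
Hypotheses (e_enc : forall x, e (enc x) = x).
Variable G : (T -> T) -> Prop.
Hypotheses (HG : is_subgroup T G) (HGc : closed_in_S T G).
Hypothesis big : forall Gamma n, exists x, ~ card_le T (orbit T (pstab T G Gamma) x) n.

(* A branch of the tree encodes a block permutation [f]; the involution [s] sends the point of
   [f] at [t] to the point of [f^-1] at [f t]. *)
Lemma block_perms_induced : exists (x : nat -> T) (s : T -> T),
  (forall t m, x t = x m -> t = m) /\ Sym T s /\
  forall f fi, block_perm f fi -> exists k, generated T G (s :: nil) k /\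
    forall t, k (x t) = x (f t).
Proof.
  destruct (tree_of_translates T e enc e_enc G HG HGc big (list nat) restrictions)
    as [x [b [Hb Htree]]].
  pose (B := fun t f => b (str (list nat) (restriction f) (S t))).
  assert (HB : forall f fi f' fi' t m, block_perm f fi -> block_perm f' fi' ->
    B t f = B m f' -> t = m /\ agree (Nat.sqrt t) f f').
  { intros f fi f' fi' t m Hf Hf' E. apply str_restriction_eq.
    apply (Hb t m); [| |exact E]; apply str_in; intros k; eapply restriction_in; eauto. }
  assert (Hg : forall f fi, block_perm f fi -> exists g, G g /\ forall t, g (x t) = B t f).
  { intros f fi Hf. apply Htree. intros k. apply (restriction_in f fi), Hf. }
  destruct (involution_of_matching T (fun y y' => exists f fi t,
    block_perm f fi /\ y = B t f /\ y' = B (f t) fi)) as [s [Hs [HsM _]]].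
  { intros y y' [f [fi [t [Hf [-> ->]]]]]. exists fi, f, (f t).
    split; [apply block_perm_sym, Hf|]. rewrite (proj1 (proj1 Hf)). auto. }
  (* Equal values force the same [t] and agreement up to its block, hence the same image of [t] and,
     by [agree_inverse], the same word for the inverses. *)
  { intros y y' y'' [f [fi [t [Hf [-> ->]]]]] [f' [fi' [m [Hf' [E ->]]]]].
    apply (HB f fi f' fi') in E; auto. destruct E as [<- E].
    unfold B. f_equal. apply str_restriction_eq. rewrite <- (E t) by lia.
    split; [reflexivity|]. rewrite (proj2 Hf). apply (agree_inverse _ f fi f' fi'); auto. }
  exists x, s. split; [|split].
  - assert (Hid : block_perm (fun t => t) (fun t => t)) by (repeat split).
    destruct (Hg _ _ Hid) as [g [_ Hgx]]. intros t m E.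
    apply (HB _ _ _ _ t m Hid Hid). rewrite <- !Hgx, E. reflexivity.
  - exact (inverse_Sym _ _ _ Hs).
  - intros f fi Hf. destruct (Hg f fi Hf) as [g [Gg Hgx]].
    destruct (Hg fi f (block_perm_sym _ _ Hf)) as [g' [Gg' Hgx']].
    destruct (proj1 HG g' Gg') as [gi' Hgi'].
    (* The three factors send [x t] to [B t f], then to [B (f t) fi], then to [x (f t)]. *)
    exists (fun z => gi' (s (g z))). split.
    + intros H HH HGH HsH. apply (subgroup_comp T H (fun z => s (g z)) gi' HH).
      * apply (subgroup_comp T H g s HH); [auto|]. apply HsH. left. reflexivity.
      * apply (subgroup_inverse T H g' gi' HH); auto.
    + intros t. rewrite Hgx, (HsM _ (B (f t) fi)), <- Hgx'; [apply Hgi'|].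
      exists f, fi, t. auto.
Qed.

(* An element [k] inducing [pi] on the copies [i >= 0] of each rung and fixing the copies [i < 0]
   is uncontrolled off these copies. The shift [w : i -> i + 1] of the copies fixes all other
   points, so [k w k^-1 w^-1] is [pi] on the copies [i = 0] and trivial everywhere else. *)
Lemma rung_perms_of_large_orbits : exists d, ladder T d /\ preceq T (rung_perm T d) G.
Proof.
  destruct block_perms_induced as [x [s [xinj [Ss Hind]]]].
  pose (y := fun j i a => x (position j i a)).
  assert (yinj : forall j i a j' i' a', a <= j -> a' <= j' -> y j i a = y j' i' a' ->
    j = j' /\ i = i' /\ a = a').
  { intros j i a j' i' a' Ha Ha' E. apply position_inj; auto. }
  pose (Y := fun z => exists j i a, a <= j /\ z = y j i a).
  destruct (bij_of_relation T T (fun z z' =>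
    (exists j i a, a <= j /\ z = y j i a /\ z' = y j (i + 1)%Z a) \/ (~ Y z /\ z' = z)))
    as [w [[wi [Hw1 Hw2]] Hw]].
  { intros z. destruct (classic (Y z)) as [[j [i [a [Ha ->]]]]|H]; [|eauto].
    exists (y j (i + 1)%Z a). left. exists j, i, a. auto. }
  { intros z. destruct (classic (Y z)) as [[j [i [a [Ha ->]]]]|H]; [|eauto].
    exists (y j (i - 1)%Z a). left. exists j, (i - 1)%Z, a.
    replace (i - 1 + 1)%Z with i by lia. auto. }
  { intros z z1 z2 [[j [i [a [Ha [-> ->]]]]]|[Hz ->]] [[j' [i' [a' [Ha' [E ->]]]]]|[Hz' ->]].
    - apply yinj in E; auto. destruct E as [-> [-> ->]]. reflexivity.
    - destruct Hz'. exists j, i, a. auto.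
    - destruct Hz. exists j', i', a'. auto.
    - reflexivity. }
  { intros z z' u [[j [i [a [Ha [-> ->]]]]]|[Hz ->]] [[j' [i' [a' [Ha' [-> E]]]]]|[Hz' E]].
    - apply yinj in E; auto. destruct E as [-> [E ->]]. f_equal. lia.
    - destruct Hz'. rewrite <- E. exists j, (i + 1)%Z, a. auto.
    - destruct Hz. rewrite E. exists j', (i' + 1)%Z, a'. auto.
    - exact E. }
  assert (wY : forall j i a, a <= j -> w (y j i a) = y j (i + 1)%Z a).
  { intros j i a Ha. destruct (Hw (y j i a)) as [[j' [i' [a' [Ha' [E ->]]]]]|[H _]].
    - apply yinj in E; auto. destruct E as [-> [-> ->]]. reflexivity.
    - destruct H. exists j, i, a. auto. }
  assert (wN : forall z, ~ Y z -> w z = z).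
  { intros z Hz. destruct (Hw z) as [[j' [i' [a' [Ha' [-> _]]]]]|[_ H]]; [|exact H].
    destruct Hz. exists j', i', a'. auto. }
  assert (wiY : forall j i a, a <= j -> wi (y j i a) = y j (i - 1)%Z a).
  { intros j i a Ha. replace i with (i - 1 + 1)%Z at 1 by lia. rewrite <- wY by auto. apply Hw1. }
  assert (wiN : forall z, ~ Y z -> wi z = z).
  { intros z Hz. rewrite <- (wN z Hz) at 1. apply Hw1. }
  pose (d := fun j a => y j 0%Z a).
  assert (Hd : ladder T d).
  { intros j a j' a' Ha Ha' E. apply yinj in E; tauto. }
  exists d. split; [exact Hd|]. exists (s :: w :: nil). split.
  { intros u [<-|[<-|[]]]; [exact Ss|]. exists wi. auto. }
  intros pi [rho [[Hpr1 Hpr2] [[Hpi Hpi0] [Hrho Hrho0]]]].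
  destruct (choice_fun (nat * nat) nat (fun ja a' => snd ja <= fst ja ->
    a' <= fst ja /\ pi (d (fst ja) (snd ja)) = d (fst ja) a')) as [p Hp].
  { intros [j a]. simpl. destruct (le_dec a j) as [Ha|Ha].
    - destruct (Hpi j a Ha) as [a' Ha']. eauto.
    - exists 0. tauto. }
  destruct (choice_fun (nat * nat) nat (fun ja a' => snd ja <= fst ja ->
    a' <= fst ja /\ rho (d (fst ja) (snd ja)) = d (fst ja) a')) as [q Hq].
  { intros [j a]. simpl. destruct (le_dec a j) as [Ha|Ha].
    - destruct (Hrho j a Ha) as [a' Ha']. eauto.
    - exists 0. tauto. }
  pose (p' := fun j a => p (j, a)). pose (q' := fun j a => q (j, a)).
  assert (Hp' : forall j a, a <= j -> p' j a <= j /\ pi (d j a) = d j (p' j a))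
    by (intros j a; apply (Hp (j, a))).
  assert (Hq' : forall j a, a <= j -> q' j a <= j /\ rho (d j a) = d j (q' j a))
    by (intros j a; apply (Hq (j, a))).
  assert (Hqp : forall j a, a <= j -> q' j (p' j a) = a).
  { intros j a Ha. destruct (Hp' j a Ha) as [H1 H2]. destruct (Hq' j (p' j a) H1) as [H3 H4].
    rewrite <- H2, Hpr1 in H4. apply Hd in H4; auto. destruct H4. auto. }
  assert (Hpq : forall j a, a <= j -> p' j (q' j a) = a).
  { intros j a Ha. destruct (Hq' j a Ha) as [H1 H2]. destruct (Hp' j (q' j a) H1) as [H3 H4].
    rewrite <- H2, Hpr2 in H4. apply Hd in H4; auto. destruct H4. auto. }
  destruct (Hind (half_line_perm p') (half_line_perm q')) as [k [Gk Hk]].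
  { split; [split|].
    - apply half_line_perm_cancel; [intros j a Ha; apply Hp', Ha|exact Hqp].
    - apply half_line_perm_cancel; [intros j a Ha; apply Hq', Ha|exact Hpq].
    - intros t. apply half_line_perm_block. intros j a Ha. apply Hp', Ha. }
  assert (Sk : Sym T k).
  { assert (HU : forall u, In u (s :: nil) -> Sym T u) by (intros u [<-|[]]; exact Ss).
    exact (proj1 (generated_subgroup T G _ (proj1 HG) HU) k Gk). }
  destruct Sk as [ki [Hki1 Hki2]].
  assert (kY : forall j i a, a <= j ->
    k (y j i a) = y j i (if (0 <=? i)%Z then p' j a else a)).
  { intros j i a Ha. unfold y. rewrite Hk. unfold position.
    rewrite half_line_perm_at, zcode_even by auto. reflexivity. }
  assert (kiY : forall j i a, a <= j ->
    ki (y j i a) = y j i (if (0 <=? i)%Z then q' j a else a)).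
  { intros j i a Ha. destruct (Hq' j a Ha) as [Hqa _]. specialize (Hpq j a Ha).
    specialize (kY j i (if (0 <=? i)%Z then q' j a else a)).
    rewrite <- (Hki1 (y j i (if (0 <=? i)%Z then q' j a else a))). f_equal.
    rewrite kY; destruct (0 <=? i)%Z; auto. }
  (* So [ki] preserves the complement of [Y], where [w] is the identity and [k] cancels against
     [ki]. *)
  assert (kiN : forall z, ~ Y z -> ~ Y (ki z)).
  { intros z Hz [j [i [a [Ha E]]]]. apply Hz. apply (f_equal k) in E.
    rewrite Hki2, kY in E by auto. exists j, i, (if (0 <=? i)%Z then p' j a else a).
    split; [|exact E]. destruct (0 <=? i)%Z; [apply Hp', Ha|exact Ha]. }
  assert (Epi : pi = fun z => k (w (ki (wi z)))).
  { apply functional_extensionality. intros z.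
    destruct (classic (Y z)) as [[j [i [a [Ha ->]]]]|Hz].
    - rewrite wiY, kiY by auto. destruct (Hq' j a Ha) as [Hqa _].
      rewrite wY by (destruct (0 <=? i - 1)%Z; auto).
      replace (i - 1 + 1)%Z with i by lia.
      rewrite kY by (destruct (0 <=? i - 1)%Z; auto).
      assert (Hoff : i <> 0%Z -> pi (y j i a) = y j i a).
      { intros Hi. apply Hpi0. intros j' a' Ha' E. apply yinj in E; auto. tauto. }
      (* For [i >= 1] both [q'] and [p'] act and cancel; for [i < 0] neither acts. At [i = 0] the
         copy [i - 1] is on the negative side, so [p'] acts alone. *)
      destruct (Z.leb_spec 0 (i - 1)), (Z.leb_spec 0 i); try lia.
      + rewrite Hpq by auto. apply Hoff. lia.
      + replace i with 0%Z by lia. apply Hp', Ha.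
      + apply Hoff. lia.
    - rewrite (wiN z Hz), (wN _ (kiN z Hz)), Hki2. apply Hpi0.
      intros j a Ha ->. apply Hz. exists j, 0%Z, a. auto. }
  intros H HH HGH HU. rewrite Epi.
  assert (Kk : H k).
  { apply Gk; auto. intros u [<-|[]]. apply HU. left. reflexivity. }
  assert (Kw : H w) by (apply HU; right; left; reflexivity).
  assert (Kki : H ki) by (apply (subgroup_inverse T H k ki HH Kk); split; auto).
  assert (Kwi : H wi) by (apply (subgroup_inverse T H w wi HH Kw); split; auto).
  exact (subgroup_comp T H _ _ HH (subgroup_comp T H _ _ HH (subgroup_comp T H _ _ HH Kwi Kki) Kw) Kk).
Qed.
End LargeOrbits.

(** * Partitions and stabilizers *)

Section Conclusion.
Variables (T : Type) (e : nat -> T) (enc : T -> nat).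
Hypotheses (e_enc : forall x, e (enc x) = x) (enc_e : forall n, enc (e n) = n).
Implicit Types (f g h : T -> T) (x y z : T) (l : list T) (A B : (T -> Prop) -> Prop).

(** Members are chosen recursively, each exceeding the size bounds of its predecessors, hence
    pairwise disjoint; the [j]-th one supplies the [j + 1] points of rung [j]. *)
Lemma partition_ladder A : in_P T A -> exists d, ladder T d /\ subset T (rung_perm T d) (S_A T A).
Proof.
  intros [[Hne [Hcov Hdisj]] [Hfin Hunb]].
  assert (Hbig : forall n, exists Sigma, A Sigma /\ ~ card_le T Sigma n).
  { intros n. apply NNPP. intros H. apply Hunb. exists n. intros Sigma HS.
    apply NNPP. intros H'. apply H. eauto. }
  assert (Hcard : forall Sigma, A Sigma -> exists m, card_le T Sigma m).
  { intros Sigma HS. destruct (Hfin Sigma HS) as [l Hl]. exists (length l), l. auto. }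
  pose (Inv := fun k (st : (T -> Prop) * nat) =>
    A (fst st) /\ card_le T (fst st) (snd st) /\ ~ card_le T (fst st) k).
  pose (Step := fun (k : nat) (st st' : (T -> Prop) * nat) =>
    snd st <= snd st' /\ ~ card_le T (fst st') (snd st)).
  assert (Hstep : forall k st, exists st', Inv k st' /\ Step k st st').
  { intros k [Sigma m]. destruct (Hbig (k + m)) as [Sigma' [HS' HS'']].
    destruct (Hcard Sigma' HS') as [m' Hm']. exists (Sigma', m + m').
    unfold Inv, Step. simpl. repeat split.
    - exact HS'.
    - apply (card_le_mono T _ m'); [lia|exact Hm'].
    - intros H. apply HS''. apply (card_le_mono T _ k); [lia|exact H].
    - lia.
    - intros H. apply HS''. apply (card_le_mono T _ m); [lia|exact H]. }
  (* A dummy state starts the recursion; only the invariant of its successor is kept. *)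
  destruct (Hstep 0 ((fun _ => False), 0)) as [st0 [H0 _]].
  destruct (dependent_choice _ Inv Step st0 H0) as [st Hst].
  { intros k a _. destruct (Hstep (S k) a) as [b Hb]. exists b. exact Hb. }
  assert (Hmono : forall k m, k <= m -> snd (st k) <= snd (st m)).
  { induction 1 as [|m _ IH]; [lia|]. pose proof (proj1 (proj2 (Hst m))). lia. }
  assert (Hlt : forall k m x, k < m -> fst (st k) x -> ~ fst (st m) x).
  { intros k [|m] x Hkm Hk Hm; [lia|].
    destruct (Hst k) as [[Ak [Ck _]] _]. destruct (Hst (S m)) as [[Am _] _].
    destruct (Hst m) as [_ [_ Nm]]. apply Nm.
    apply (card_le_mono T _ (snd (st k))); [apply Hmono; lia|].
    destruct Ck as [l [Hl Hin]]. exists l. split; [exact Hl|]. intros y Hy. apply Hin.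
    apply (Hdisj _ _ x Ak Am Hk Hm), Hy. }
  assert (Hd : forall j, exists dj : nat -> T, (forall a, a <= j -> fst (st j) (dj a)) /\
    (forall a b, a <= j -> b <= j -> dj a = dj b -> a = b)).
  { intros j. apply not_card_le_inj; [exact (e 0)|]. apply (proj1 (Hst j)). }
  destruct (choice_fun _ _ _ Hd) as [d Hd'].
  exists d. split.
  - intros j a j' a' Ha Ha' E.
    pose proof (proj1 (Hd' j) a Ha) as H1. pose proof (proj1 (Hd' j') a' Ha') as H2.
    rewrite <- E in H2. destruct (lt_eq_lt_dec j j') as [[H|H]|H].
    + destruct (Hlt j j' _ H H1 H2).
    + subst j'. split; [reflexivity|]. apply (Hd' j); auto.
    + destruct (Hlt j' j _ H H2 H1).
  - assert (Hal : forall g Sigma x, along T d g -> A Sigma -> Sigma x -> Sigma (g x)).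
    { intros g Sigma x [Hg1 Hg2] HS Hx.
      destruct (classic (exists j a, a <= j /\ x = d j a)) as [[j [a [Ha ->]]]|H].
      - destruct (Hg1 j a Ha) as [a' [Ha' ->]].
        apply (Hdisj Sigma (fst (st j)) (d j a)); auto; [apply (Hst j)| |]; apply Hd'; auto.
      - rewrite Hg2; [exact Hx|]. intros j a Ha E. apply H. eauto. }
    intros f [g [[H1 H2] [Hf Hg]]]. split; [exists g; split; auto|].
    intros Sigma HS z. split.
    + intros [x [Hx <-]]. apply Hal; auto.
    + intros Hz. exists (g z). split; [apply Hal; auto|apply H2].
Qed.

(** Word metric for the relation of lying in a common member of [A] and the generators in [U],
    padded with the identity. Elements of [S_A] have displacement at most 1. *)
Lemma partition_gauge A U : in_P T A -> (forall u, In u U -> Sym T u) ->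
  exists R, gauge T R /\ (forall k x, finite_set T (R k x)) /\
    subset T (generated T (S_A T A) U) (bounded_displacement T R).
Proof.
  intros [[Hne [Hcov Hdisj]] [Hfin _]] HU.
  pose (E := fun x y => exists Sigma, A Sigma /\ Sigma x /\ Sigma y).
  pose (c := fun j => nth j U (fun x => x)).
  assert (HE : forall x y, E x y -> E y x).
  { intros x y [Sigma H]. exists Sigma. tauto. }
  assert (Hc : forall j, Sym T (c j)).
  { intros j. unfold c. destruct (nth_in_or_default j U (fun x => x)) as [H| ->]; [auto|].
    exact (proj1 (proj2 (Sym_subgroup T))). }
  pose proof (word_gauge T E c HE) as HR.
  exists (fun k => path T E c k k). split; [exact HR|]. split.
  - intros k x. apply word_gauge_locally_finite; auto. clear x. intros x.
    destruct (Hcov x) as [Sigma [HS Hx]]. destruct (Hfin Sigma HS) as [l Hl].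
    exists l. intros y [Sigma' [HS' [Hx' Hy]]]. apply Hl, (Hdisj _ _ x HS' HS Hx' Hx), Hy.
  - intros f Hf. apply Hf.
    + apply bounded_displacement_subgroup, HR.
    + intros g [Sg Hg]. split; [exact Sg|]. exists 1. intros x.
      apply word_gauge_relation. destruct (Hcov x) as [Sigma [HS Hx]]. exists Sigma.
      repeat split; auto. apply (Hg Sigma HS). exists x. auto.
    + intros u Hu. split; [auto|].
      destruct (In_nth U u (fun x => x) Hu) as [j [_ Hj]]. exists (S j). intros x.
      rewrite <- Hj. apply (word_gauge_gen T E c j x).
Qed.

Fixpoint code (w : list nat) : nat :=
  match w with
  | nil => 0
  | a :: w => S (to_nat (a, code w))
  end.

Lemma code_inj w w' : code w = code w' -> w = w'.
Proof.
  revert w'. induction w as [|a w IH]; intros [|a' w'] H; try discriminate; [reflexivity|].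
  cbn [code] in H. apply Nat.succ_inj, to_nat_inj in H. inversion H. f_equal; auto.
Qed.

(** Elements agreeing on [Gamma] differ by an element of the stabilizer, and there are only
    countably many tuples of images of [Gamma]; [key] codes such a tuple. *)
Lemma stabilizer_cosets G Gamma : is_subgroup T G -> exists c : nat -> T -> T,
  (forall j, G (c j)) /\
  forall g, G g -> exists j h, pstab T G Gamma h /\ forall x, g x = c j (h x).
Proof.
  intros HG. pose (key := fun g => code (map enc (map g Gamma))).
  destruct (choice_fun nat (T -> T) (fun j g => G g /\
    forall f, G f -> key f = j -> key g = j)) as [c Hc].
  { intros j. destruct (classic (exists g, G g /\ key g = j)) as [[g [Hg E]]|H].
    - exists g. auto.
    - exists (fun x => x). split; [apply HG|]. intros f Hf E. destruct H. eauto. }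
  exists c. split; [apply Hc|]. intros g Gg. exists (key g).
  destruct (Hc (key g)) as [Gc Hkey]. specialize (Hkey g Gg eq_refl).
  destruct (proj1 HG _ Gc) as [ci [Hci1 Hci2]].
  exists (fun x => ci (g x)). split; [split|].
  - apply (subgroup_comp T G g ci HG Gg). apply (subgroup_inverse T G (c (key g)) ci HG Gc).
    split; auto.
  - intros x Hx. apply code_inj in Hkey. rewrite !map_map in Hkey.
    pose proof (ext_in_map Hkey x Hx) as Ex.
    apply (enc_inj T e enc e_enc) in Ex. rewrite <- Ex. apply Hci1.
  - intros x. symmetry. apply Hci2.
Qed.

(** The generators are the entries of [U] followed by the coset representatives. An element of [G]
    is one step along a stabilizer orbit followed by one representative, so its displacement is
    bounded, with a bound depending on the coset. *)
Lemma stabilizer_gauge G Gamma U : is_subgroup T G -> (forall u, In u U -> Sym T u) ->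
  exists R, gauge T R /\
    (all_orbits_finite T (pstab T G Gamma) -> forall k x, finite_set T (R k x)) /\
    (orbits_bounded T (pstab T G Gamma) -> forall k, exists m, forall x, card_le T (R k x) m) /\
    subset T (generated T G U) (bounded_displacement T R).
Proof.
  intros HG HU. destruct (stabilizer_cosets G Gamma HG) as [c0 [Gc0 Hc0]].
  pose (E := orbit T (pstab T G Gamma)).
  pose (c := fun j => if j <? length U then nth j U (fun x => x) else c0 (j - length U)).
  assert (HE : forall x y, E x y -> E y x).
  { intros x y [h [[Gh Hh] <-]]. destruct (proj1 HG h Gh) as [hi Hhi]. exists hi.
    split; [split|apply Hhi].
    - exact (subgroup_inverse T G h hi HG Gh Hhi).
    - intros z Hz. rewrite <- (Hh z Hz) at 1. apply Hhi. }
  assert (Hc : forall j, Sym T (c j)).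
  { intros j. unfold c. destruct (Nat.ltb_spec j (length U)).
    - apply HU, nth_In. auto.
    - apply HG, Gc0. }
  pose proof (word_gauge T E c HE) as HR.
  exists (fun k => path T E c k k). split; [exact HR|]. split; [|split].
  - intros Hf k x. apply word_gauge_locally_finite; auto.
  - intros [b Hb] k. exact (word_gauge_uniformly_finite T E c Hc b Hb k k).
  - intros f Hf. apply Hf.
    + apply bounded_displacement_subgroup, HR.
    + intros g Gg. split; [apply HG, Gg|]. destruct (Hc0 g Gg) as [j [h [Hh Eg]]].
      exists (1 + S (j + length U)). intros x. rewrite Eg.
      apply (gauge_comp _ _ HR 1 _ x (h x)).
      * apply word_gauge_relation. exists h. auto.
      * replace (c0 j) with (c (j + length U)); [apply (word_gauge_gen T E c)|].
        unfold c. destruct (Nat.ltb_spec (j + length U) (length U)); [lia|].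
        f_equal. lia.
    + intros u Hu. split; [auto|].
      destruct (In_nth U u (fun x => x) Hu) as [j [Hj Ej]]. exists (S j). intros x.
      replace u with (c j); [apply (word_gauge_gen T E c)|].
      unfold c. destruct (Nat.ltb_spec j (length U)); [auto|lia].
Qed.

(* Diagonalization: on rung [J k] some point is farther than [k] from [d (J k) 0]. *)
Lemma rung_perms_not_uniform R d : gauge T R -> ladder T d ->
  (forall k, exists m, forall x, card_le T (R k x) m) ->
  ~ subset T (rung_perm T d) (bounded_displacement T R).
Proof.
  intros HR Hd HN Hsub. destruct (choice_fun _ _ _ HN) as [N HN'].
  (* Rung [J k] has more than [N k] points, too many for a [k]-ball; pairing with [k] makes [J]
     injective, so different [k] use disjoint rungs. *)
  pose (J := fun k => to_nat (k, N k)).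
  assert (HJ : forall k, N k <= J k).
  { intros k. unfold J. pose proof (to_nat_non_decreasing k (N k)). lia. }
  assert (HJi : forall k m, J k = J m -> k = m).
  { intros k m E. apply to_nat_inj in E. congruence. }
  destruct (choice_fun _ _ (fun k a => a <= J k /\ ~ R k (d (J k) 0) (d (J k) a))) as [a Ha].
  { intros k. apply NNPP. intros Hn. destruct (HN' k (d (J k) 0)) as [l [Hl Hin]].
    assert (Hle : length (map (d (J k)) (seq 0 (S (J k)))) <= length l).
    { apply NoDup_incl_length.
      - apply NoDup_map_NoDup_ForallPairs; [|apply seq_NoDup]. intros b b' Hb Hb' E.
        apply in_seq in Hb, Hb'. apply Hd in E; lia.
      - intros z Hz. apply in_map_iff in Hz. destruct Hz as [b [<- Hb]]. apply in_seq in Hb.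
        apply Hin, NNPP. intros H. apply Hn. exists b. split; [lia|exact H]. }
    rewrite length_map, length_seq in Hle. specialize (HJ k). lia. }
  destruct (involution_of_matching T (fun z z' => exists k,
    (z = d (J k) 0 /\ z' = d (J k) (a k)) \/ (z = d (J k) (a k) /\ z' = d (J k) 0)))
    as [t [Ht [HtM HtN]]].
  { intros z z' [k H]. exists k. tauto. }
  { assert (Hk : forall k m b b', b <= J k -> b' <= J m -> d (J k) b = d (J m) b' ->
      k = m /\ b = b').
    { intros k m b b' Hb Hb' E. apply Hd in E; auto. split; [apply HJi|]; apply E. }
    intros z z1 z2 [k [[E1 ->]|[E1 ->]]] [m [[E2 ->]|[E2 ->]]]; rewrite E1 in E2;
      apply Hk in E2; try apply Ha; try lia; destruct E2 as [<- E2]; congruence. }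
  assert (Hal : along T d t).
  { split.
    - intros j b Hb.
      destruct (classic (exists z', exists k,
        (d j b = d (J k) 0 /\ z' = d (J k) (a k)) \/ (d j b = d (J k) (a k) /\ z' = d (J k) 0)))
        as [[z' [k H]]|H].
      + assert (E : t (d j b) = z') by (apply HtM; eauto).
        destruct (Ha k) as [Hak _].
        destruct H as [[Ed Ez]|[Ed Ez]]; apply Hd in Ed; auto; try lia; destruct Ed as [-> _];
          rewrite E, Ez; [exists (a k)|exists 0]; split; auto; lia.
      + exists b. split; [exact Hb|]. apply HtN. intros z' Hz'. apply H. eauto.
    - intros z Hz. apply HtN. intros z' [k [[E _]|[E _]]]; revert E; apply Hz; [lia|apply Ha]. }
  destruct (Hsub t) as [_ [k Hk]]; [exists t; auto|].
  apply (proj2 (Ha k)). rewrite <- (HtM (d (J k) 0) (d (J k) (a k))); [apply Hk|]. exists k. auto.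
Qed.

(** * Comparison of partition groups with closed groups *)

Lemma partition_preceq A d : in_P T A -> ladder T d -> preceq T (S_A T A) (rung_perm T d).
Proof.
  intros HA Hd. destruct (partition_gauge A nil HA) as [R [HR [Hfin Hsub]]]; [intros u []|].
  apply (preceq_trans T _ (bounded_displacement T R)).
  - apply subset_preceq. intros f Hf. apply Hsub, generated_base, Hf.
  - apply (bounded_displacement_preceq T e enc); auto.
Qed.

Lemma partitions_preceq A B : in_P T A -> in_P T B -> preceq T (S_A T A) (S_A T B).
Proof.
  intros HA HB. destruct (partition_ladder B HB) as [d [Hd Hsub]].
  apply (preceq_trans T _ (rung_perm T d)); [apply partition_preceq; auto|].
  apply subset_preceq, Hsub.
Qed.

Lemma preceq_partition_finite_orbits A G : in_P T A -> is_subgroup T G -> closed_in_S T G ->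
  preceq T G (S_A T A) -> exists Gamma, all_orbits_finite T (pstab T G Gamma).
Proof.
  intros HA HG HGc [U [HU HGU]]. destruct (partition_gauge A U HA HU) as [R [HR [Hfin Hsub]]].
  apply (finite_orbits_of_bounded_displacement T e enc e_enc G HG HGc R Hfin).
  intros g Gg. apply Hsub, HGU, Gg.
Qed.

(** A common bound on the orbits would bound uniformly the balls of the metric attached to [G] and
    [U], which the rung group inside [S_A] forbids. *)
Lemma partition_preceq_unbounded_orbits A G Gamma : in_P T A -> is_subgroup T G ->
  preceq T (S_A T A) G -> ~ orbits_bounded T (pstab T G Gamma).
Proof.
  intros HA HG [U [HU HAU]] Hb.
  destruct (stabilizer_gauge G Gamma U HG HU) as [R [HR [_ [Hunif Hsub]]]].
  destruct (partition_ladder A HA) as [d [Hd Hdsub]].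
  apply (rung_perms_not_uniform R d HR Hd (Hunif Hb)).
  intros f Hf. apply Hsub, HAU, Hdsub, Hf.
Qed.

Lemma finite_orbits_preceq A G Gamma : in_P T A -> is_subgroup T G ->
  all_orbits_finite T (pstab T G Gamma) -> preceq T G (S_A T A).
Proof.
  intros HA HG Hf.
  destruct (stabilizer_gauge G Gamma nil HG) as [R [HR [Hfin [_ Hsub]]]]; [intros u []|].
  destruct (partition_ladder A HA) as [d [Hd Hdsub]].
  apply (preceq_trans T _ (bounded_displacement T R)).
  { apply subset_preceq. intros f Gf. apply Hsub, generated_base, Gf. }
  apply (preceq_trans T _ (rung_perm T d)); [|apply subset_preceq, Hdsub].
  apply (bounded_displacement_preceq T e enc); auto.
Qed.

Lemma unbounded_orbits_preceq A G : in_P T A -> is_subgroup T G -> closed_in_S T G ->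
  ~ (exists Gamma, orbits_bounded T (pstab T G Gamma)) -> preceq T (S_A T A) G.
Proof.
  intros HA HG HGc Hunb.
  destruct (rung_perms_of_large_orbits T e enc e_enc G HG HGc) as [d [Hd Hpre]].
  { intros Gamma n. apply not_all_ex_not. intros H. apply Hunb. exists Gamma, n. exact H. }
  apply (preceq_trans T _ (rung_perm T d)); [apply partition_preceq; auto|exact Hpre].
Qed.

(** [Sym T] is closed, so some pointwise stabilizer would have finite orbits; but transpositions
    join any two points outside [Gamma]. *)
Lemma Sym_not_preceq A : in_P T A -> ~ preceq T (Sym T) (S_A T A).
Proof.
  intros HA Hpre.
  destruct (preceq_partition_finite_orbits A (Sym T) HA (Sym_subgroup T)) as [Gamma Hfin].
  { intros f Sf _. exact Sf. }
  { exact Hpre. }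
  destruct (escape_list T e enc enc_e Gamma) as [x Hx]. destruct (Hfin x) as [l Hl].
  destruct (escape_list T e enc enc_e (Gamma ++ l)) as [y Hy]. rewrite in_app_iff in Hy.
  apply Hy. right. apply Hl. exists (swap T x y). split; [split|apply swap_l].
  - exact (inverse_Sym _ _ _ (swap_inverse T x y)).
  - intros z Hz. apply swap_other; intros ->; tauto.
Qed.
End Conclusion.

Theorem theorem6p2 (T : Type) (HT : countably_infinite T) :
  (forall A B, in_P T A -> in_P T B -> approx T (S_A T A) (S_A T B)) /\
  (forall A, in_P T A ->
     forall G, is_subgroup T G -> closed_in_S T G ->
       (approx T G (S_A T A) <->
         ((exists Gamma : list T, all_orbits_finite T (pstab T G Gamma)) /\
          ~ (exists Gamma : list T, orbits_bounded T (pstab T G Gamma))))) /\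
  (forall A, in_P T A -> prec T (S_A T A) (Sym T)).
Proof.
  destruct HT as [e [enc [enc_e e_enc]]]. split; [|split].
  - intros A B HA HB. split; apply (partitions_preceq T e enc); auto.
  - intros A HA G HG HGc. split.
    + intros [H1 H2]. split.
      * apply (preceq_partition_finite_orbits T e enc e_enc A); auto.
      * intros [Gamma Hb]. revert Hb.
        apply (partition_preceq_unbounded_orbits T e enc e_enc A); auto.
    + intros [[Gamma Hf] Hunb]. split.
      * apply (finite_orbits_preceq T e enc e_enc enc_e A G Gamma); auto.
      * apply (unbounded_orbits_preceq T e enc e_enc enc_e); auto.
  - intros A HA. split.
    + apply subset_preceq. intros f [Sf _]. exact Sf.
    + apply (Sym_not_preceq T e enc e_enc enc_e A HA).
Qed.
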